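(* Let $i\in\mathbb{N}$, $\alpha\in\mathbb{R}$ and $\beta\ge0$. (1) The function $x\mapsto x^\alpha\bigl|\psi^{(i)}(x)\bigr|$ is strictly increasing on $(0,\infty)$ if and only if $\alpha\ge i+1$, and it is strictly decreasing on $(0,\infty)$ if and only if $\alpha\le i$. (2) For $\beta\ge\frac12$, the function $x\mapsto x^\alpha\bigl|\psi^{(i)}(x+\beta)\bigr|$ is strictly increasing on $[0,\infty)$ if and only if $\alpha\ge i$. (3) Let $\delta:(0,\infty)\to\bigl(0,\frac12\bigr)$ be defined by $\delta(t)=\frac{e^t(t-1)+1}{(e^t-1)^2}$ and let $\delta^{-1}:\bigl(0,\frac12\bigr)\to(0,\infty)$ be the inverse function of $\delta$. If $0<\beta<\frac12$ and $$\alpha\ge i+1-\biggl[\frac{e^{\delta^{-1}(\beta)}}{e^{\delta^{-1}(\beta)}-1}+\beta-1\biggr]\delta^{-1}(\beta),$$ then the function $x\mapsto x^\alpha\bigl|\psi^{(i)}(x+\beta)\bigr|$ is strictly increasing on $(0,\infty)$.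
   Context: Here $\mathbb{N}=\{1,2,3,\dots\}$. For $x>0$, $\Gamma(x)=\int_0^\infty t^{x-1}e^{-t}\,dt$ is the Euler gamma function, $\psi(x)=\Gamma'(x)/\Gamma(x)$ is the psi (digamma) function, and $\psi^{(k)}$ for $k\in\mathbb{N}$ denotes the $k$-th derivative of $\psi$ (a polygamma function). The function $\delta$ is a strictly decreasing bijection from $(0,\infty)$ onto $\bigl(0,\frac12\bigr)$, so $\delta^{-1}$ is well defined. *)

(* Defs.v *)
From HB Require Import structures.
From mathcomp Require Import all_boot all_order all_algebra.
From mathcomp Require Import all_classical all_reals all_analysis.
Set Implicit Arguments.
Unset Strict Implicit.
Unset Printing Implicit Defensive.
Import Order.TTheory GRing.Theory Num.Theory.
Import numFieldNormedType.Exports.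
Local Open Scope classical_set_scope.
Local Open Scope ring_scope.

(* Meaningful for 0 < x only: for x <= 0 the integral diverges and the
   real-valued integral takes the junk value 0. *)
Definition Gamma {R : realType} (x : R) : R :=
  \int[lebesgue_measure]_(t in `]0, +oo[) (t `^ (x - 1) * expR (- t)).

Definition psi {R : realType} (x : R) : R := derive1 Gamma x / Gamma x.

Definition polygamma {R : realType} (k : nat) : R -> R := derive1n k psi.

Definition strictly_increasing_on {R : realType} (I : interval R) (f : R -> R)
  : Prop := {in I &, {homo f : x y / x < y}}.

Definition strictly_decreasing_on {R : realType} (I : interval R) (f : R -> R)
  : Prop := {in I &, {homo f : x y /~ x < y}}.

Definition delta {R : realType} (t : R) : R :=
  (expR t * (t - 1) + 1) / (expR t - 1) ^+ 2.

(* delta restricts to a bijection from ]0, +oo[ onto ]0, 1/2[; its inverse is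
   therefore meaningful on ]0, 1/2[ only. *)
Definition delta_inv {R : realType} : R -> R :=
  'pinv_(fun=> 0) [set t : R | 0 < t] delta.

(* Main.v *)
(* Gamma is log-convex and satisfies the functional equation, so ln Gamma has at
   every x > 0 the subgradient lim (ln (x + n) - \sum_(k < n) 1 / (x + k)).  That
   limit is concave, the series S_s(x) = \sum_k 1 / (x + k) ^ s are convex, and a
   continuous subgradient is a derivative; no uniform convergence is needed to
   obtain |psi^(i)(x)| = i! S_(i+1)(x).

   Everything then depends on the sign of
   alpha S_(i+1)(x + beta) - (i + 1) x S_(i+2)(x + beta).  For beta = 0 and for
   beta >= 1/2 it is found by comparing terms with telescoping sums; for
   0 < beta < 1/2 it is the integral over t > 0 of a positive function of t times
   alpha - (i + 1) + h(t), with h(t) = t (beta + 1 / (e^t - 1)), up to the factor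
   i!.  Since h' = beta - delta, the minimum of h is at delta^-1(beta).  The
   conditions on alpha are necessary because S_(i+1)(x) is equivalent to
   x^-(i+1) at 0 and to x^-i / i at infinity. *)
Require Import Defs.
From HB Require Import structures.
From mathcomp Require Import all_boot all_order all_algebra.
From mathcomp Require Import all_classical all_reals all_analysis.
From mathcomp Require Import measurable_realfun ring lra.
Set Implicit Arguments.
Unset Strict Implicit.
Unset Printing Implicit Defensive.
Import Order.TTheory GRing.Theory Num.Theory.
Import numFieldNormedType.Exports.
Local Open Scope classical_set_scope.
Local Open Scope ring_scope.

(** * Tangent inequalities and subgradients *)

Lemma ln_ge1BV (R : realType) (u : R) : 0 < u -> 1 - u^-1 <= ln u.
Proof.
move=> u0; have := @le_ln1Dx R (u^-1 - 1).
rewrite subrKC lnV ?posrE// ltrBrDl subrr invr_gt0 => /(_ u0).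
by rewrite lerNl opprB.
Qed.

(** [u ^ p = exp (p ln u)] is at least [1 + p ln u], and [ln u >= 1 - 1 / u]. The bound holds for
    every [p >= 0], and under a Gamma integral its term [p / u] merely shifts an exponent by one. *)
Lemma powR_ge_tangent (R : realType) (p u : R) : 0 <= p -> 0 < u ->
  1 + p - p / u <= u `^ p.
Proof.
move=> p0 u0; rewrite /powR gt_eqF//; apply: le_trans (expR_ge1Dx _).
by have := ler_wpM2l p0 (ln_ge1BV u0); lra.
Qed.

Lemma powR_gt_tangent (R : realType) (p u : R) : 0 < p -> 0 < u -> u != 1 ->
  1 + p - p / u < u `^ p.
Proof.
move=> p0 u0 u1; rewrite /powR gt_eqF//.
apply: (@le_lt_trans _ _ (1 + p * ln u)).
  by have := ler_wpM2l (ltW p0) (ln_ge1BV u0); lra.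
by rewrite expR_gt1Dx// mulf_neq0 ?(gt_eqF p0)// ln_eq0.
Qed.

(** The previous bound at [u = a / b] with exponent [s], multiplied by [a ^- s], is the tangent at
    [a] to the convex function [t ^- s]. *)
Lemma exprVn_ge_tangent (R : realType) s (a b : R) : 0 < a -> 0 < b ->
  - (s%:R * (b - a) * a ^- s.+1) <= b ^- s - a ^- s.
Proof.
move=> a0 b0; have := @powR_ge_tangent R s%:R (a / b) (ler0n _ _) (divr_gt0 a0 b0).
rewrite powR_mulrn ?divr_ge0 ?(ltW a0) ?(ltW b0)// expr_div_n invfM invrK.
rewrite -(ler_pM2r (_ : 0 < a ^- s)) ?invr_gt0 ?exprn_gt0//.
rewrite mulrAC mulfV ?mul1r ?gt_eqF ?exprn_gt0// => h.
rewrite lerBrDr; apply: le_trans h; rewrite le_eqVlt; apply/orP; left; apply/eqP.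
by rewrite exprS; field; rewrite ?expf_neq0 gt_eqF.
Qed.

Lemma exprVn_gt_tangent (R : realType) s (a b : R) : 0 < a -> 0 < b -> a != b ->
  - (s.+1%:R * (b - a) * a ^- s.+2) < b ^- s.+1 - a ^- s.+1.
Proof.
move=> a0 b0 ab.
have ab1 : a / b != 1 by rewrite -subr_eq0 -[X in _ - X](mulfV (lt0r_neq0 b0))
  -mulrBl mulf_neq0 ?invr_eq0 ?subr_eq0// gt_eqF.
have := @powR_gt_tangent R s.+1%:R (a / b) (ltr0Sn _ _) (divr_gt0 a0 b0) ab1.
rewrite powR_mulrn ?divr_ge0 ?(ltW a0) ?(ltW b0)// expr_div_n invfM invrK.
rewrite -(ltr_pM2r (_ : 0 < a ^- s.+1)) ?invr_gt0 ?exprn_gt0//.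
rewrite mulrAC mulfV ?mul1r ?gt_eqF ?exprn_gt0// => h.
rewrite ltrBrDr; apply: le_lt_trans h; rewrite le_eqVlt; apply/orP; left; apply/eqP.
rewrite [in LHS]exprS; field.
by rewrite expf_neq0 gt_eqF.
Qed.

(** Using the inequality at [x] and at [x + h] traps the difference quotient between [G x] and
    [G (x + h)]; continuity of [G] closes the gap. *)
Lemma subgradient_is_derive (R : realType) (F G : R -> R) (x : R) : 0 < x ->
  (forall a b, 0 < a -> 0 < b -> (b - a) * G a <= F b - F a) ->
  {for x, continuous G} -> is_derive x 1 F (G x).
Proof.
move=> x0 FG cG.
suff cv : h^-1 *: (F (h *: (1:R) + x) - F x) @[h --> 0^'] --> G x.
  by apply: DeriveDef; [apply: cvgP cv|apply/cvg_lim].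
apply/cvgrPdist_le => e e0.
have nG : \forall h \near (0:R)^', `|G x - G (h + x)| <= e.
  have /cvgrPdist_le/(_ e e0) nG := cG.
  have c : (h + x) @[h --> (0 : R)] --> x.
    by rewrite -[X in _ --> X]add0r; apply: cvgD; [exact: cvg_id|exact: cvg_cst].
  by apply: cvg_within; exact: c _ nG.
near=> h.
have h0 : h != 0 by near: h; exact: nbhs_dnbhs_neq.
have xh : 0 < h + x.
  rewrite -ltrBlDr sub0r; near: h; apply: cvg_within.
  by apply: lt_nbhsr; rewrite oppr_lt0.
have ne : `|G x - G (h + x)| <= e by near: h.
have := FG _ _ x0 xh; have := FG _ _ xh x0.
rewrite /= /GRing.scale/= mulr1 => h1 h2.
set D := F (h + x) - F x in h2 *.
have {}h1 : (x - (h + x)) * G (h + x) <= - D by rewrite opprB.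
have hh : h * (h^-1 * D) = D by rewrite mulrA mulfV// mul1r.
move: ne; rewrite !ler_norml => /andP[n1 n2].
(* In the branch [hp], [h] is negative and dividing by it reverses both inequalities; in [hn] it is
   positive. *)
have [hp|hn|h00] := ltgtP h 0; last by rewrite h00 eqxx in h0.
- have {}h1 : h^-1 * D >= G (h + x).
    by rewrite -(ler_nM2l hp) hh; lra.
  have {}h2 : h^-1 * D <= G x by rewrite -(ler_nM2l hp) hh; lra.
  by apply/andP; split; lra.
- have {}h1 : h^-1 * D <= G (h + x) by rewrite -(ler_pM2l hn) hh; lra.
  have {}h2 : h^-1 * D >= G x by rewrite -(ler_pM2l hn) hh; lra.
  by apply/andP; split; lra.
Unshelve. all: by end_near. Qed.

(** [F] is Lipschitz near [x]: its slopes to the right of [x / 2] are bounded by [H (x / 2)], as [H]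
    is nonincreasing. The added 1 in [M] makes the constant positive. *)
Lemma subgradient_continuous (R : realType) (F H : R -> R) (x : R) : 0 < x ->
  (forall a, 0 < a -> 0 <= H a) ->
  (forall a b, 0 < a -> a <= b -> H b <= H a) ->
  (forall a b, 0 < a -> 0 < b -> - ((b - a) * H a) <= F b - F a) ->
  {for x, continuous F}.
Proof.
move=> x0 H0 Hd FH.
have x20 : 0 < x / 2 by rewrite divr_gt0.
set M := H (x / 2) + 1.
have M0 : 0 < M by rewrite ltr_wpDl ?H0.
apply/cvgrPdist_le => e e0; near=> y.
have yx : x / 2 < y.
  by near: y; apply: lt_nbhsr; rewrite ltr_pdivrMr// ltr_pMr// ltr1n.
have y0 : 0 < y by exact: lt_trans yx.
have yd : `|x - y| <= e / M.
  by near: y; apply: (@cvgr_dist_le _ _ _ _ _ id); [exact: cvg_id|rewrite divr_gt0].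
have Hx : H x <= M.
  by apply: ler_wpDr => //; apply: Hd => //; rewrite ler_pdivrMr// ler_pMr// ler1n.
have Hy : H y <= M by apply: ler_wpDr => //; apply: Hd => //; rewrite ltW.
rewrite ler_pdivlMr// in yd; apply: le_trans yd.
have h1 := FH _ _ x0 y0; have h2 := FH _ _ y0 x0.
have h3 := H0 _ x0; have h4 := H0 _ y0.
have [xy|xy] := leP x y.
  have -> : `|x - y| = y - x by rewrite distrC ger0_norm// subr_ge0.
  by rewrite ler_norml; apply/andP; split; nra.
have -> : `|x - y| = x - y by rewrite ger0_norm// subr_ge0 ltW.
by rewrite ler_norml; apply/andP; split; nra.
Unshelve. all: by end_near. Qed.

(** * The series of shifted inverse powers *)

Section ShiftedPowers.
Context {R : realType}.
Implicit Types (x y : R) (s n : nat).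

Definition hurwitz_sum s x n : R := \sum_(k < n) (x + k%:R) ^- s.

(** The Hurwitz zeta function at a natural exponent. The series converges for [x > 0] and exponents
    at least 2, whence [s.+2] below; exponent 1 enters only through partial sums. *)
Definition hurwitz s x : R := limn (hurwitz_sum s x).

Lemma addrn_gt0 x n : 0 < x -> 0 < x + n%:R.
Proof. by move=> x0; rewrite ltr_wpDr. Qed.

Lemma addrn_neq0 x n : 0 < x -> x + n%:R != 0.
Proof. by move=> x0; rewrite gt_eqF// addrn_gt0. Qed.

Lemma hurwitz_sumS s x n :
  hurwitz_sum s x n.+1 = hurwitz_sum s x n + (x + n%:R) ^- s.
Proof. by rewrite /hurwitz_sum big_ord_recr. Qed.

Lemma hurwitz_sum0 s x : hurwitz_sum s x 0 = 0.
Proof. by rewrite /hurwitz_sum big_ord0. Qed.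

Lemma cvg_addrnV x : 0 < x -> (x + n%:R)^-1 @[n --> \oo] --> (0 : R).
Proof.
move=> x0; apply/gtr0_cvgV0; first by apply: nearW => n; exact: addrn_gt0.
apply/cvgryPge => A; near=> n; rewrite (@le_trans _ _ n%:R) ?lerDr ?(ltW x0)//.
by near: n; exact: nbhs_infty_ger.
Unshelve. all: by end_near. Qed.

Lemma cvg_addrnXV s x : 0 < x -> (x + n%:R) ^- s.+1 @[n --> \oo] --> (0 : R).
Proof.
move=> x0; elim: s => [|s IH]; first exact: cvg_addrnV.
rewrite (_ : (fun n => _) = (fun n => (x + n%:R) ^- s.+1) \* (fun n => (x + n%:R)^-1)).
  by rewrite -[X in _ --> X](mulr0 0); apply: cvgM => //; exact: cvg_addrnV.
by apply/funext => n; rewrite exprSr invfM.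
Qed.

(** This bound and the next, both tangent inequalities between consecutive points, compare the
    series with a telescoping one, in place of an integral test. *)
Lemma exprVn_step_le s x n : 0 < x ->
  s.+1%:R * (x + n.+1%:R) ^- s.+2 <= (x + n%:R) ^- s.+1 - (x + n.+1%:R) ^- s.+1.
Proof.
move=> x0; have := exprVn_ge_tangent s.+1 (addrn_gt0 n.+1 x0) (addrn_gt0 n x0).
by rewrite -[in _ - _]natr1 addrA opprD addrA subrr sub0r mulrN1 mulNr opprK.
Qed.

Lemma exprVn_step_ge s x n : 0 < x ->
  (x + n%:R) ^- s.+1 - (x + n.+1%:R) ^- s.+1 <= s.+1%:R * (x + n%:R) ^- s.+2.
Proof.
move=> x0; have := exprVn_ge_tangent s.+1 (addrn_gt0 n x0) (addrn_gt0 n.+1 x0).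
rewrite -[X in (_ * (_ + X - _))]natr1 addrA [x + _ + 1]addrC addrK mulr1.
by rewrite lerNl opprB.
Qed.

Lemma hurwitz_sum_le s x n : 0 < x ->
  hurwitz_sum s.+2 x n <= x ^- s.+2 + x ^- s.+1 / s.+1%:R.
Proof.
move=> x0; case: n => [|n].
  by rewrite hurwitz_sum0 addr_ge0 ?mulr_ge0 ?invr_ge0 ?exprn_ge0// ltW.
(* The induction needs the sharper bound that keeps the telescoping remainder. *)
suff : hurwitz_sum s.+2 x n.+1 <=
    x ^- s.+2 + (x ^- s.+1 - (x + n%:R) ^- s.+1) / s.+1%:R.
  move/le_trans; apply; rewrite lerD2l ler_pM2r ?invr_gt0// gerBl.
  by rewrite invr_ge0 exprn_ge0// ltW// addrn_gt0.
elim: n => [|n IH].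
  by rewrite hurwitz_sumS hurwitz_sum0 add0r addr0 subrr mul0r addr0.
rewrite hurwitz_sumS; move: IH (exprVn_step_le s n x0).
rewrite [s.+1%:R * _]mulrC -ler_pdivlMr//.
move: (x ^- s.+2) (x ^- s.+1) ((x + n%:R) ^- s.+1) ((x + n.+1%:R) ^- s.+1)
  ((x + n.+1%:R) ^- s.+2) (s.+1%:R^-1) (hurwitz_sum _ _ _) => a b c d e f g.
lra.
Qed.

Lemma hurwitz_sum_nd s x : 0 < x -> nondecreasing_seq (hurwitz_sum s x).
Proof.
move=> x0; apply/nondecreasing_seqP => n; rewrite hurwitz_sumS lerDl.
by rewrite invr_ge0 exprn_ge0// ltW// addrn_gt0.
Qed.

Lemma cvg_hurwitz s x : 0 < x -> hurwitz_sum s.+2 x @ \oo --> hurwitz s.+2 x.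
Proof.
move=> x0; apply: nondecreasing_is_cvgn; first exact: hurwitz_sum_nd.
by exists (x ^- s.+2 + x ^- s.+1 / s.+1%:R) => _ [n _ <-]; exact: hurwitz_sum_le.
Qed.

Arguments cvg_hurwitz s [x].

Lemma hurwitz_sum_le_hurwitz s x n : 0 < x ->
  hurwitz_sum s.+2 x n <= hurwitz s.+2 x.
Proof.
move=> x0; apply: nondecreasing_cvgn_le; first exact: hurwitz_sum_nd.
exact: cvgP (cvg_hurwitz s x0).
Qed.

Lemma hurwitz_le s x : 0 < x -> hurwitz s.+2 x <= x ^- s.+2 + x ^- s.+1 / s.+1%:R.
Proof.
move=> x0; apply: (cvgr_to_le (cvg_hurwitz s x0)).
by apply: nearW => n; exact: hurwitz_sum_le.
Qed.

Lemma hurwitz_ge s x : 0 < x -> x ^- s.+1 / s.+1%:R <= hurwitz s.+2 x.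
Proof.
move=> x0; have lhs : (x ^- s.+1 - (x + n%:R) ^- s.+1) / s.+1%:R @[n --> \oo]
    --> x ^- s.+1 / s.+1%:R.
  rewrite -[X in X / _]subr0; apply: cvgMl; apply: cvgB; first exact: cvg_cst.
  exact: cvg_addrnXV.
apply: (ler_cvg_to lhs (cvg_hurwitz s x0)); apply: nearW => n.
rewrite ler_pdivrMr//; elim: n => [|n IH].
  by rewrite hurwitz_sum0 addr0 subrr mul0r.
rewrite hurwitz_sumS mulrDl; have := exprVn_step_ge s n x0; lra.
Qed.

Lemma hurwitz_ge_exprVn s x : 0 < x -> x ^- s.+2 <= hurwitz s.+2 x.
Proof.
move=> x0; apply: le_trans (hurwitz_sum_le_hurwitz s 1 x0).
by rewrite hurwitz_sumS hurwitz_sum0 add0r addr0.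
Qed.

Lemma hurwitz_gt0 s x : 0 < x -> 0 < hurwitz s.+2 x.
Proof.
move=> x0; apply: lt_le_trans (hurwitz_ge_exprVn s x0).
by rewrite invr_gt0 exprn_gt0.
Qed.

Lemma hurwitz_nincr s x y : 0 < x -> x <= y -> hurwitz s.+2 y <= hurwitz s.+2 x.
Proof.
move=> x0 xy; have y0 := lt_le_trans x0 xy.
apply: (ler_cvg_to (cvg_hurwitz s y0) (cvg_hurwitz s x0)); apply: nearW => n.
apply: ler_sum => k _; rewrite lef_pV2 ?posrE ?exprn_gt0 ?addrn_gt0//.
by rewrite lerXn2r ?nnegrE ?lerD2r// ltW// addrn_gt0.
Qed.

(** The tangent inequality holds term by term and passes to the limit. *)
Lemma hurwitz_subgradient s x y : 0 < x -> 0 < y ->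
  - (s.+2%:R * (y - x) * hurwitz s.+3 x) <= hurwitz s.+2 y - hurwitz s.+2 x.
Proof.
move=> x0 y0.
have L : - (s.+2%:R * (y - x) * hurwitz_sum s.+3 x n) @[n --> \oo]
    --> - (s.+2%:R * (y - x) * hurwitz s.+3 x).
  by apply: cvgN; apply: cvgMr; exact: cvg_hurwitz.
have L2 : hurwitz_sum s.+2 y n - hurwitz_sum s.+2 x n @[n --> \oo]
    --> hurwitz s.+2 y - hurwitz s.+2 x by apply: cvgB; exact: cvg_hurwitz.
apply: (ler_cvg_to L L2); apply: nearW => n.
rewrite -sumrB mulr_sumr -sumrN; apply: ler_sum => k _.
rewrite (_ : y - x = y + k%:R - (x + k%:R)); last by rewrite opprD addrACA subrr addr0.
by apply: exprVn_ge_tangent; exact: addrn_gt0.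
Qed.

Lemma hurwitz_continuous s x : 0 < x -> {for x, continuous (hurwitz s.+2)}.
Proof.
move=> x0; apply: (@subgradient_continuous _ _ (fun y => s.+2%:R * hurwitz s.+3 y)) => //.
- by move=> a a0; rewrite mulr_ge0// ltW// hurwitz_gt0.
- by move=> a b a0 ab; rewrite ler_pM2l// hurwitz_nincr.
- by move=> a b a0 b0; rewrite mulrCA mulrA hurwitz_subgradient.
Qed.

Lemma is_derive_hurwitz s x : 0 < x ->
  is_derive x 1 (hurwitz s.+2) (- (s.+2%:R * hurwitz s.+3 x)).
Proof.
move=> x0.
apply: (@subgradient_is_derive _ _ (fun y => - (s.+2%:R * hurwitz s.+3 y))) => //.
- by move=> a b a0 b0; rewrite mulrN mulrCA mulrA hurwitz_subgradient.
- by apply: cvgN; apply: cvgMr; exact: hurwitz_continuous.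
Qed.

End ShiftedPowers.

(** * The integrals of t^p exp(-at) *)

Section LaplacePower.
Context {R : realType}.
Notation mu := (@lebesgue_measure R).
Implicit Types p q a t : R.

Definition laplace_pow p a t : R := t `^ p * expR (- (a * t)).

(** Extended real values allow integration by parts and monotone limits before finiteness is
    known. *)
Definition laplace_int p a : \bar R :=
  (\int[mu]_(t in `]0%R, +oo[) (laplace_pow p a t)%:E)%E.

Lemma laplace_pow_ge0 p a t : 0 <= laplace_pow p a t.
Proof. by rewrite mulr_ge0 ?powR_ge0 ?expR_ge0. Qed.

Lemma measurable_laplace_pow (D : set R) p a : measurable_fun D (laplace_pow p a).
Proof.
apply: measurable_funTS; apply: measurable_funM; first exact: measurable_powR.
apply: (measurableT_comp (@measurable_expR R)).
by apply: measurableT_comp => //; exact: mulrl_measurable.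
Qed.

Lemma measurable_laplace_powE (D : set R) p a :
  measurable_fun D (EFin \o laplace_pow p a).
Proof. by apply/measurable_EFinP; exact: measurable_laplace_pow. Qed.

Lemma laplace_int_ge0 p a : (0 <= laplace_int p a)%E.
Proof. by apply: integral_ge0 => t _; rewrite lee_fin laplace_pow_ge0. Qed.

Lemma is_derive_expRNM a t :
  is_derive t 1 (fun u => expR (- (a * u))) (- (a * expR (- (a * t)))).
Proof.
have h : is_derive t 1 (fun u : R => - (a * u)) (- a).
  by apply: is_derive_eq; rewrite /GRing.scale/= ?mulr1 ?mulr0 ?addr0.
by apply: is_derive_eq; rewrite mulrN mulrC.
Qed.

(** A single Taylor term, [(a t) ^ m.+1 / m.+1!], bounds [exp (a t)] from below; since [m] exceeds
    [|p|], it outweighs [t ^ p] by a factor of order [t]. *)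
Lemma laplace_pow_le p a t (m := Num.bound `|p|) : 0 < a -> 1 <= t ->
  laplace_pow p a t <= m.+1`!%:R / a ^+ m.+1 * t^-1.
Proof.
move=> a0 t1; have t0 : 0 < t by exact: lt_le_trans t1.
have tm : t `^ p <= t ^+ m.
  by rewrite -powR_mulrn ?(ltW t0)// ler_powR// (le_trans (ler_norm p))// ltW// archi_boundP.
have /le_trans-/(_ _ (lexx _)) := @expR_ge1Dxn R (a * t) m (mulr_ge0 (ltW a0) (ltW t0)).
move=> h; rewrite /laplace_pow expRN ler_pdivrMr ?expR_gt0//.
apply: (le_trans tm); apply: (@le_trans _ _ (m.+1`!%:R / a ^+ m.+1 * t^-1 *
  ((a * t) ^+ m.+1 / m.+1`!%:R))).
  rewrite le_eqVlt; apply/orP; left; apply/eqP.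
  rewrite exprMn [t ^+ m.+1]exprS; field.
  by rewrite (gt_eqF t0) expf_neq0 ?gt_eqF// ltr0n fact_gt0.
rewrite ler_wpM2l//; first by rewrite !mulr_ge0 ?invr_ge0 ?exprn_ge0 ?(ltW a0) ?(ltW t0).
by apply: le_trans h; rewrite lerDr.
Qed.

Lemma cvg_laplace_pow p a (v : nat -> R) : 0 < a ->
  (forall n, 1 <= v n) -> (v n)^-1 @[n --> \oo] --> (0 : R) ->
  laplace_pow p a (v n) @[n --> \oo] --> (0 : R).
Proof.
move=> a0 v1 v0; set m := Num.bound `|p|.
have C : m.+1`!%:R / a ^+ m.+1 * (v n)^-1 @[n --> \oo] --> (0 : R).
  by rewrite -[X in _ --> X](mulr0 (m.+1`!%:R / a ^+ m.+1)); apply: cvgMr.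
apply: squeeze_cvgr (cvg_cst 0) C.
by apply: nearW => n; rewrite laplace_pow_ge0 laplace_pow_le.
Qed.

Lemma continuous_laplace_pow p a (u v : R) : 0 < u ->
  {within `[u, v], continuous (laplace_pow p a)}.
Proof.
move=> u0; apply: derivable_within_continuous => t; rewrite in_itv/= => /andP[ut _].
apply: derivableM.
  by apply: ex_derive; apply: is_derive1_powR; exact: lt_le_trans ut.
by apply: ex_derive; exact: is_derive_expRNM.
Qed.

Lemma integrable_laplace_pow_itv p a (u v : R) : 0 < u ->
  mu.-integrable `[u, v] (EFin \o laplace_pow p a).
Proof.
move=> u0; apply: continuous_compact_integrable; first exact: segment_compact.
exact: continuous_laplace_pow.
Qed.

(** The segment stays away from 0, where [t ^ q] need not be differentiable; the half-line is
    reached by exhaustion. *)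
Lemma laplace_pow_parts q a (u v : R) : 0 < u -> u < v ->
  (q%:E * \int[mu]_(t in `[u, v]) (laplace_pow (q - 1) a t)%:E =
   (laplace_pow q a v - laplace_pow q a u)%:E +
   a%:E * \int[mu]_(t in `[u, v]) (laplace_pow q a t)%:E)%E.
Proof.
move=> u0 uv.
have pos t : t \in `[u, v] -> 0 < t.
  by rewrite in_itv/= => /andP[ut _]; exact: lt_le_trans ut.
have oc t : t \in `]u, v[ -> 0 < t.
  by rewrite in_itv/= => /andP[ut _]; exact: lt_trans ut.
have dF t : 0 < t -> is_derive t 1 (fun x : R => x `^ q) (q * t `^ (q - 1)).
  by move=> t0; exact: is_derive1_powR.
have dG t : is_derive t 1 (fun x : R => expR (- (a * x))) (- (a * expR (- (a * t)))).
  exact: is_derive_expRNM.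
have cd (f : R -> R) t : derivable f t 1 -> {for t, continuous f}.
  by move=> /derivable1_diffP/differentiable_continuous.
have v0 := lt_trans u0 uv.
have cf : {within `[u, v], continuous (fun t : R => q * t `^ (q - 1))}.
  apply: derivable_within_continuous => t /pos t0; apply: derivableM => //.
  by apply: ex_derive; exact: is_derive1_powR.
have cg : {within `[u, v], continuous (fun t : R => - (a * expR (- (a * t))))}.
  apply: derivable_within_continuous => t _; apply: derivableN; apply: derivableM => //.
have F1 : derivable_oo_LRcontinuous (fun x : R => x `^ q) u v.
  split.
  + by move=> t /oc/dF/@ex_derive.
  + by apply: cvg_at_right_filter; apply: (cd (fun x : R => x `^ q)); case: (dF _ u0).
  + by apply: cvg_at_left_filter; apply: (cd (fun x : R => x `^ q)); case: (dF _ v0).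
have F2 : {in `]u, v[, (fun x : R => x `^ q)^`()%classic =1 (fun t : R => q * t `^ (q - 1))}.
  by move=> t /oc t0; rewrite derive1E; case: (dF _ t0).
have G1 : derivable_oo_LRcontinuous (fun t : R => expR (- (a * t))) u v.
  split.
  + by move=> t _; case: (dG t).
  + by apply: cvg_at_right_filter; apply: (cd (fun t : R => expR (- (a * t)))); case: (dG u).
  + by apply: cvg_at_left_filter; apply: (cd (fun t : R => expR (- (a * t)))); case: (dG v).
have G2 : {in `]u, v[, (fun t : R => expR (- (a * t)))^`()%classic =1
    (fun t : R => - (a * expR (- (a * t))))}.
  by move=> t _; rewrite derive1E; case: (dG t).
have := integration_by_parts uv cf F1 F2 cg G1 G2.
have -> : (\int[mu]_(x in `[u, v]) (x `^ q * - (a * expR (- (a * x))))%:E =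
    (- a)%:E * \int[mu]_(t in `[u, v]) (laplace_pow q a t)%:E)%E.
  rewrite -integralZl//; last exact: integrable_laplace_pow_itv.
  by apply: eq_integral => t _; rewrite -EFinM /laplace_pow; congr EFin; ring.
have -> : (\int[mu]_(x in `[u, v]) (q * x `^ (q - 1) * expR (- (a * x)))%:E =
    q%:E * \int[mu]_(t in `[u, v]) (laplace_pow (q - 1) a t)%:E)%E.
  rewrite -integralZl//; last exact: integrable_laplace_pow_itv.
  by apply: eq_integral => t _; rewrite -EFinM /laplace_pow mulrA.
have fin p : (\int[mu]_(t in `[u, v]) (laplace_pow p a t)%:E)%E \is a fin_num.
  by apply: integrable_fin_num => //; exact: integrable_laplace_pow_itv.
rewrite -(fineK (fin q)) -(fineK (fin (q - 1))).
rewrite -!EFinM -!EFinB -EFinD => -[h]; congr EFin; rewrite /laplace_pow.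
by move: h; rewrite mulNr; lra.
Qed.

End LaplacePower.

Section LaplacePowerValue.
Context {R : realType}.
Notation mu := (@lebesgue_measure R).
Implicit Types (p q a t x : R) (n : nat).

(** These segments exhaust the positive half-line. The offset 2 keeps the left endpoint strictly
    below the right one even for [n = 0]. *)
Local Notation I n := (`[(2 + n%:R)^-1, (2 + n%:R)]%classic : set R).

Let two_gt0 n : (0 : R) < 2 + n%:R.
Proof. by rewrite addrn_gt0. Qed.

Let bigcup_segments : \bigcup_n I n = `]0, +oo[%classic.
Proof.
apply/seteqP; split=> [t [n _]|t] /=; rewrite !in_itv/= ?andbT.
  by case/andP => h _; apply: lt_le_trans h; rewrite invr_gt0.
move=> t0; have Vt0 : 0 < t^-1 by rewrite invr_gt0.
exists (Num.bound (t + t^-1)) => //=; rewrite in_itv/=.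
have := archi_boundP (addr_ge0 (ltW t0) (ltW Vt0)).
set m := (Num.bound _)%:R => h.
by apply/andP; split; [rewrite -[leRHS]invrK lef_pV2 ?posrE//|]; rewrite ?/m ?two_gt0; lra.
Qed.

Lemma cvg_laplace_int_segment p a :
  (\int[mu]_(t in I n) (laplace_pow p a t)%:E)%E @[n --> \oo] --> laplace_int p a.
Proof.
rewrite /laplace_int -bigcup_segments.
refine (@ge0_nondecreasing_set_cvg_integral _ (measurableTypeR R) R
  (fun n => I n) (fun t => (laplace_pow p a t)%:E) mu _ _ _ _) => //.
- move=> m n mn; rewrite subsetEset; apply: subset_itv; rewrite bnd_simp.
    by rewrite lef_pV2 ?posrE ?two_gt0// lerD2l ler_nat.
  by rewrite lerD2l ler_nat.
- by move=> n; exact: measurable_laplace_powE.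
- by move=> n t _; rewrite lee_fin laplace_pow_ge0.
Qed.

(** The boundary term at infinity vanishes; the one at 0 is left as [c], since it is 0 for [q > 0]
    but 1 for [q = 0]. *)
Lemma laplace_int_parts q a (c : R) : 0 < a ->
  laplace_pow q a (2 + n%:R)^-1 @[n --> \oo] --> c ->
  (q%:E * laplace_int (q - 1) a = (- c)%:E + a%:E * laplace_int q a)%E.
Proof.
move=> a0 cc.
have L : (q%:E * \int[mu]_(t in I n) (laplace_pow (q - 1) a t)%:E)%E @[n --> \oo]
    --> (q%:E * laplace_int (q - 1) a)%E.
  by apply: cvgeZl => //; exact: cvg_laplace_int_segment.
have cB : laplace_pow q a (2 + n%:R) - laplace_pow q a (2 + n%:R)^-1 @[n --> \oo]
    --> - c.
  rewrite -[X in _ --> X]sub0r; apply: cvgB => //; apply: cvg_laplace_pow => //.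
    by move=> n; rewrite ler_wpDr// ler1n.
  exact: cvg_addrnV.
have : ((laplace_pow q a (2 + n%:R) - laplace_pow q a (2 + n%:R)^-1)%:E +
    a%:E * \int[mu]_(t in I n) (laplace_pow q a t)%:E)%E @[n --> \oo]
    --> ((- c)%:E + a%:E * laplace_int q a)%E.
  apply: cvgeD; first exact: fin_num_adde_defr.
    by apply: cvg_EFin => //; exact: nearW.
  by apply: cvgeZl => //; exact: cvg_laplace_int_segment.
apply: cvg_unique; first exact: ereal_hausdorff.
move: L; rewrite (_ : (fun n => _) = (fun n => (laplace_pow q a (2 + n%:R) -
    laplace_pow q a (2 + n%:R)^-1)%:E +
    a%:E * \int[mu]_(t in I n) (laplace_pow q a t)%:E)%E)//.
apply/funext => n; apply: laplace_pow_parts; first by rewrite invr_gt0.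
have n1 : (1 : R) < 2 + n%:R by rewrite ltr_wpDr// ltr1n.
by apply: lt_trans (n1); rewrite invf_lt1.
Qed.

Lemma laplace_int_rec q a : 0 < q -> 0 < a ->
  (q%:E * laplace_int (q - 1) a = a%:E * laplace_int q a)%E.
Proof.
move=> q0 a0; rewrite (@laplace_int_parts _ _ 0)// ?oppr0 ?add0e//.
have C : ((2 + n%:R)^-1 : R) `^ q @[n --> \oo] --> (0 : R).
  move/cvg_at_rightP : (@powR_cvg0 R q q0); apply; split; last exact: cvg_addrnV.
  by move=> n; rewrite invr_gt0.
apply: squeeze_cvgr (cvg_cst 0) C; apply: nearW => n.
rewrite laplace_pow_ge0/= /laplace_pow ler_piMr ?powR_ge0// expR_le1 oppr_le0.
by rewrite mulr_ge0 ?invr_ge0 ?ltW.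
Qed.

Lemma laplace_int_nat n a : 0 < a ->
  laplace_int n%:R a = (n`!%:R / a ^+ n.+1)%:E.
Proof.
move=> a0.
have div r (X : \bar R) : (a%:E * X = r%:E)%E -> X = (r / a)%:E.
  move=> h; rewrite mulrC EFinM -h muleA -EFinM mulVf ?mul1e// gt_eqF//.
elim: n => [|n IH].
  (* With [q = 0] the left side vanishes and the boundary value 1 at the origin gives [a] times the
     integral of [exp (- a t)]. *)
  apply: div; have := @laplace_int_parts 0 a 1 a0; rewrite mul0e => h.
  have {h} : (0%:E = (-1)%:E + a%:E * laplace_int 0 a)%E.
    apply: h; rewrite /laplace_pow.
    have E : expR (- (a * 0)) = 1 by rewrite mulr0 oppr0 expR0.
    rewrite -[X in _ --> X]E.
    have C : a * (2 + n%:R)^-1 @[n --> \oo] --> a * 0.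
      by apply: cvgMr; exact: cvg_addrnV.
    rewrite [X in X @ _ --> _](_ : _ = fun n => expR (- (a * (2 + n%:R)^-1))).
      apply: (@cvg_comp _ _ _ (fun n : nat => - (a * (2 + n%:R)^-1)) expR _
        (nbhs (- (a * 0)))); last exact: continuous_expR.
      exact: cvgN C.
    by apply/funext => n; rewrite powRr0 mul1r.
  move/(congr1 (fun z => 1%:E + z)%E); rewrite adde0 addeA -EFinD subrr add0e => <-.
  by [].
have := @laplace_int_rec n.+1%:R a (ltr0Sn _ _) a0.
rewrite -[X in laplace_int (X - 1)]natr1 addrK IH -EFinM => /esym/div ->.
by congr EFin; rewrite factS natrM [in RHS]exprSr invfM; ring.
Qed.

(** For exponents [q >= 0], [t ^ q <= 1 + t ^ m] with a natural [m > q] suffices. The recurrence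
    then carries finiteness from [p + 1] down to [p]. *)
Lemma laplace_int_lty p a : -1 < p -> 0 < a -> (laplace_int p a < +oo)%E.
Proof.
move=> p1 a0.
have pos q : 0 <= q -> (laplace_int q a < +oo)%E.
  move=> q0; pose m := Num.bound q.
  apply: (@le_lt_trans _ _ (laplace_int 0 a + laplace_int m%:R a)%E); last first.
    by rewrite (laplace_int_nat 0)// laplace_int_nat// -EFinD ltry.
  rewrite /laplace_int -ge0_integralD//; last 4 first.
  - by move=> t _; rewrite lee_fin laplace_pow_ge0.
  - exact: measurable_laplace_powE.
  - by move=> t _; rewrite lee_fin laplace_pow_ge0.
  - exact: measurable_laplace_powE.
  apply: ge0_le_integral => //.
  - by move=> t _; rewrite lee_fin laplace_pow_ge0.
  - exact: measurable_laplace_powE.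
  - by apply: emeasurable_funD; exact: measurable_laplace_powE.
  move=> t; rewrite /= in_itv/= andbT => t0.
  rewrite -EFinD lee_fin /laplace_pow -mulrDl ler_wpM2r ?expR_ge0// powRr0.
  have [t1|t1] := leP t 1.
    apply: (@le_trans _ _ 1); last by rewrite lerDl powR_ge0.
    by rewrite -(powRr0 t) ger_powR// t0.
  apply: (@le_trans _ _ (t `^ m%:R)); last by rewrite lerDr.
  by rewrite ler_powR// ltW// archi_boundP.
have p10 : 0 < p + 1 by rewrite -ltrBlDr sub0r.
have := laplace_int_rec p10 a0; rewrite addrK => h.
have : (((p + 1)%:E * laplace_int p a) < +oo)%E.
  by rewrite h lte_mul_pinfty ?lee_fin ?(ltW a0)// pos// ltW.
case: (laplace_int p a) (laplace_int_ge0 p a) => [r| |]//;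
  by rewrite ?ltry// gt0_muley ?lte_fin.
Qed.

Lemma laplace_int_fin_num p a : -1 < p -> 0 < a -> laplace_int p a \is a fin_num.
Proof. by move=> p1 a0; rewrite ge0_fin_numE ?laplace_int_ge0// laplace_int_lty. Qed.

End LaplacePowerValue.

(** * The gamma function: functional equation and bounds for ratios *)

Section GammaFunction.
Context {R : realType}.
Notation mu := (@lebesgue_measure R).
Implicit Types (p t x y z : R) (n : nat).

Lemma GammaE x : 0 < x -> (Gamma x)%:E = laplace_int (x - 1) 1.
Proof.
move=> x0; rewrite /Gamma /Rintegral -[RHS]fineK; last first.
  by rewrite laplace_int_fin_num// ltrBrDr addNr.
congr (fine _)%:E; apply: eq_integral => t _.
by rewrite /laplace_pow mul1r.
Qed.

Lemma GammaD1 x : 0 < x -> Gamma (x + 1) = x * Gamma x.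
Proof.
move=> x0; apply: EFin_inj; rewrite EFinM !GammaE ?addr_gt0//.
by rewrite laplace_int_rec// mul1e addrK.
Qed.

Lemma Gamma_nat n : Gamma (n.+1%:R : R) = n`!%:R.
Proof.
apply: EFin_inj; rewrite GammaE// -natr1 addrK laplace_int_nat//.
by rewrite expr1n divr1.
Qed.

Lemma le_GammaD x y z (b c : R) : 0 < x -> 0 < y -> 0 < z -> 0 <= b -> 0 <= c ->
  (forall t, 0 < t -> b * t `^ (x - 1) <= t `^ (y - 1) + c * t `^ (z - 1)) ->
  b * Gamma x <= Gamma y + c * Gamma z.
Proof.
move=> x0 y0 z0 b0 c0 h; rewrite -lee_fin EFinD !EFinM !GammaE// /laplace_int.
have m p := @measurable_laplace_powE R `]0%R, +oo[ p 1.
have mz (d p : R) : measurable_fun (`]0%R, +oo[%classic : set (measurableTypeR R))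
    (fun t => d%:E * (laplace_pow p 1 t)%:E)%E.
  by apply: measurable_funeM; exact: measurable_laplace_powE.
have ge p t : (0%:E <= (laplace_pow p 1 t)%:E)%E by rewrite lee_fin laplace_pow_ge0.
rewrite -ge0_integralZl//; last exact: measurable_laplace_powE.
rewrite -ge0_integralZl//; last exact: measurable_laplace_powE.
rewrite -ge0_integralD//; last 2 first.
- exact: measurable_laplace_powE.
- by move=> t _; rewrite mule_ge0// lee_fin.
apply: ge0_le_integral => //.
- by move=> t _; rewrite mule_ge0// lee_fin.
- by apply: emeasurable_funD; [exact: measurable_laplace_powE|exact: mz].
move=> t; rewrite /= in_itv/= andbT => t0.
rewrite -!EFinM -EFinD lee_fin /laplace_pow !mulrA -mulrDl ler_wpM2r ?expR_ge0//.
exact: h.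
Qed.

Let powR_div_scale p t x : 0 < t -> 0 < x -> (t / x) `^ p * x `^ p = t `^ p.
Proof. by move=> t0 x0; rewrite -powRM ?divr_ge0 ?ltW// divfK ?gt_eqF. Qed.

(** The tangent bound for [(t / s) ^ p] is integrated against [t ^ (x - 1) exp (- t)]. The centre
    [s = x - 1] is chosen so that the [s / t] term yields [s Gamma s = Gamma x] and the
    contributions with factor [p] cancel. *)
Lemma GammaD_ge p x : 0 <= p -> 1 < x -> (x - 1) `^ p * Gamma x <= Gamma (x + p).
Proof.
move=> p0 x1; have s0 : 0 < x - 1 by rewrite subr_gt0.
have x0 : 0 < x by exact: lt_trans x1.
have xp0 : 0 < x + p by rewrite ltr_wpDr.
set s := x - 1 in s0 *; set c := s `^ p.
have c0 : 0 <= c by rewrite powR_ge0.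
have := @le_GammaD x (x + p) s (c * (1 + p)) (p * c * s) x0 xp0 s0.
have s1x : s + 1 = x by rewrite /s subrK.
rewrite -[p * c * s * _]mulrA -(GammaD1 s0) s1x => h.
suff : c * (1 + p) * Gamma x <= Gamma (x + p) + p * c * Gamma x by lra.
apply: h => [| |t t0].
- by rewrite mulr_ge0// addr_ge0.
- by rewrite !mulr_ge0// ltW.
- have -> : x + p - 1 = s + p by rewrite /s addrAC.
  have tn : t != 0 by rewrite gt_eqF.
  have -> : t `^ (s + p) = t `^ s * t `^ p by rewrite powRD// tn implybT.
  have -> : t `^ (s - 1) = t `^ s / t.
    by rewrite powRB ?tn ?implybT// powRr1// ltW.
  rewrite -/s -(powR_div_scale p t0 s0) -/c.
  have := powR_ge_tangent p0 (divr_gt0 t0 s0).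
  have A0 := powR_ge0 t s; rewrite invf_div.
  have cA : 0 <= c * t `^ s by rewrite mulr_ge0.
  move/(ler_wpM2l cA); set u := _ `^ p; set A := t `^ s.
  have -> : p * c * s * (A / t) = c * A * (p * (s / t)) by ring.
  by lra.
Qed.

(** The mirror argument: the tangent bound for [(s / t) ^ p] with [s = x + p], where the [t / s]
    term yields [Gamma (s + 1) / s = Gamma s]. *)
Lemma GammaD_le p x : 0 <= p -> 0 < x -> (x + p) `^ (- p) * Gamma (x + p) <= Gamma x.
Proof.
move=> p0 x0; have s0 : 0 < x + p by rewrite ltr_wpDr.
have s10 : 0 < x + p + 1 by rewrite addr_gt0.
set s := x + p in s0 s10 *; set c := s `^ (- p).
have c0 : 0 <= c by rewrite powR_ge0.
have := @le_GammaD s x (s + 1) (c * (1 + p)) (p * c / s) s0 x0 s10.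
rewrite (GammaD1 s0) -[p * c / s * _]mulrA mulKf ?gt_eqF// => h.
suff : c * (1 + p) * Gamma s <= Gamma x + p * c * Gamma s by lra.
apply: h => [| |t t0].
- by rewrite mulr_ge0// addr_ge0.
- by rewrite !mulr_ge0// invr_ge0 ltW.
- have -> : s - 1 = (x - 1) + p by rewrite /s addrAC.
  have -> : s + 1 - 1 = (x - 1) + p + 1 by rewrite /s; ring.
  have tD r r' : t `^ (r + r') = t `^ r * t `^ r' by rewrite powRD// (gt_eqF t0) implybT.
  rewrite (tD (x - 1 + p) 1) (tD (x - 1) p) powRr1 ?(ltW t0)//.
  have := powR_ge_tangent p0 (divr_gt0 s0 t0); rewrite invf_div.
  have B0 : 0 <= t `^ p by exact: powR_ge0.
  have cB : (s / t) `^ p * (c * t `^ p) = 1.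
    rewrite mulrCA powR_div_scale// /c powRN mulVf// gt_eqF// powR_gt0//.
  have A0 := powR_ge0 t (x - 1).
  have cAB : 0 <= c * (t `^ (x - 1) * t `^ p) by rewrite !mulr_ge0.
  move/(ler_wpM2r cAB).
  have -> : (s / t) `^ p * (c * (t `^ (x - 1) * t `^ p)) = t `^ (x - 1).
    by rewrite [t `^ (x - 1) * _]mulrC !mulrA -[X in X * _]mulrA cB mul1r.
  have -> : p * c / s * (t `^ (x - 1) * t `^ p * t) =
    p * (t / s) * (c * (t `^ (x - 1) * t `^ p)) by ring.
  clear; move: (p * (t / s)) (t `^ (x - 1)) (t `^ p) => Y A B; lra.
Qed.

End GammaFunction.

(** * The digamma and polygamma functions *)

Section Digamma.
Context {R : realType}.
Implicit Types (a b p t x y z : R) (n : nat).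

(** Comparison with a factorial [Gamma m.+1 = m!] beyond [x]. *)
Lemma Gamma_gt0 x : 0 < x -> 0 < Gamma x.
Proof.
move=> x0; set m := Num.bound x.
have xm : 0 <= m.+1%:R - x.
  by rewrite subr_ge0 ltW// (lt_le_trans (archi_boundP (ltW x0)))// ler_nat.
apply: lt_le_trans (GammaD_le xm x0).
by rewrite subrKC Gamma_nat mulr_gt0 ?powR_gt0 ?ltr0n ?fact_gt0.
Qed.

Lemma ln_sub_le a b : 0 < a -> 0 < b -> ln b - ln a <= (b - a) / a.
Proof.
move=> a0 b0; rewrite -ln_div ?posrE// mulrBl mulfV ?gt_eqF//.
rewrite -[X in ln X](subrKC 1) le_ln1Dx// ltrBrDl subrr.
by rewrite divr_gt0.
Qed.

Lemma ln_GammaDn x n : 0 < x ->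
  ln (Gamma (x + n%:R)) = ln (Gamma x) + \sum_(k < n) ln (x + k%:R).
Proof.
move=> x0; elim: n => [|n IH]; first by rewrite big_ord0 !addr0.
have xn := addrn_gt0 n x0.
rewrite big_ord_recr/= addrA -IH -natr1 addrA GammaD1// lnM ?posrE ?Gamma_gt0//.
exact: addrC.
Qed.

Definition digamma_seq x n : R := ln (x + n%:R) - hurwitz_sum 1 x n.

Definition digamma x : R := limn (digamma_seq x).

(** The two tangent bounds for [ln (x + n.+1) - ln (x + n)] make the sequence nonincreasing and
    bounded below; the extra [1 / (x + n)] in the lower bound is what the induction carries. *)
Lemma cvg_digamma x : 0 < x -> digamma_seq x @ \oo --> digamma x.
Proof.
move=> x0; apply: nonincreasing_is_cvgn.
  apply/nonincreasing_seqP => n; rewrite /digamma_seq hurwitz_sumS expr1.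
  have := ln_sub_le (addrn_gt0 n x0) (addrn_gt0 n.+1 x0).
  have -> : x + n.+1%:R - (x + n%:R) = 1 by rewrite -natr1; ring.
  by rewrite mul1r; lra.
exists (ln x - x^-1) => _ [n _ <-].
suff : ln x - x^-1 + (x + n%:R)^-1 <= digamma_seq x n.
  by apply: le_trans; rewrite lerDl invr_ge0 ltW// addrn_gt0.
elim: n => [|n]; first by rewrite /digamma_seq hurwitz_sum0 addr0 subr0 subrK.
rewrite /digamma_seq hurwitz_sumS expr1.
have := ln_sub_le (addrn_gt0 n.+1 x0) (addrn_gt0 n x0).
have -> : x + n%:R - (x + n.+1%:R) = - 1 by rewrite -natr1; ring.
by rewrite mulN1r; lra.
Qed.

(** The functional equation moves both points to the right by [n], where the ratio bounds for Gamma
    are sharp enough; log-convexity itself is never invoked. *)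
Lemma ln_Gamma_subgradient x y : 0 < x -> 0 < y ->
  (y - x) * digamma x <= ln (Gamma y) - ln (Gamma x).
Proof.
move=> x0 y0.
have cD : (y - x) * digamma_seq x n @[n --> \oo] --> (y - x) * digamma x.
  by apply: cvgMr; exact: cvg_digamma.
(* Cancelling the common terms leaves [ln (y + k) - ln (x + k) <= (y - x) / (x + k)], summed over
   [k < n]. *)
have step n : ln (Gamma (y + n%:R)) - ln (Gamma (x + n%:R)) -
    (y - x) * hurwitz_sum 1 x n <= ln (Gamma y) - ln (Gamma x).
  move: (ln_GammaDn n x0) (ln_GammaDn n y0).
  move: (ln (Gamma (x + _))) (ln (Gamma (y + _))) (ln (Gamma x)) (ln (Gamma y)).
  move=> _ _ lx ly -> ->; rewrite lerBlDr -lerBlDl opprD addrACA [ly + _]addrC.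
  rewrite [leLHS](_ : _ = \sum_(k < n) ln (y + k%:R) - \sum_(k < n) ln (x + k%:R)).
  rewrite -sumrB mulr_sumr; apply: ler_sum => k _; rewrite expr1.
  have := ln_sub_le (addrn_gt0 k x0) (addrn_gt0 k y0).
  by rewrite [in _ - (_ + _)]opprD addrACA subrr addr0.
  ring.
have [xy|yx] := leP x y.
  (* [GammaD_ge] at [x + n.+1] involves the base [x + n], so the logarithm lags one index behind the
     sum; the resulting term [1 / (x + n)] tends to 0. *)
  have cE : (y - x) * (digamma_seq x n - (x + n%:R)^-1) @[n --> \oo]
      --> (y - x) * digamma x.
    apply: cvgMr; rewrite -[X in _ --> X]subr0; apply: cvgB.
      exact: cvg_digamma.
    exact: cvg_addrnV.
  apply: (cvgr_to_le cE); apply: nearW => n; apply: le_trans (step n.+1).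
  rewrite hurwitz_sumS expr1 /digamma_seq -addrA -opprD mulrBr lerD2r.
  have xn1 : 1 < x + n.+1%:R by rewrite -natr1 addrA ltrDr addrn_gt0.
  have yx0 : 0 <= y - x by rewrite subr_ge0.
  have := GammaD_ge yx0 xn1.
  have -> : x + n.+1%:R + (y - x) = y + n.+1%:R by ring.
  have -> : x + n.+1%:R - 1 = x + n%:R by rewrite -natr1; ring.
  move=> h.
  have xn := addrn_gt0 n x0.
  have xSn := addrn_gt0 n.+1 x0; have ySn := addrn_gt0 n.+1 y0.
  rewrite -ln_powR lerBrDr -lnM ?posrE ?powR_gt0 ?Gamma_gt0//.
  by rewrite ler_ln ?posrE ?mulr_gt0 ?powR_gt0 ?Gamma_gt0.
apply: (cvgr_to_le cD); apply: nearW => n; apply: le_trans (step n).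
rewrite /digamma_seq mulrBr lerD2r.
have yx0 : 0 <= x - y by rewrite subr_ge0 ltW.
have := GammaD_le yx0 (addrn_gt0 n y0).
have -> : y + n%:R + (x - y) = x + n%:R by ring.
rewrite opprB => h.
have xn := addrn_gt0 n x0; have yn := addrn_gt0 n y0.
rewrite -ln_powR lerBrDr -lnM ?posrE ?powR_gt0 ?Gamma_gt0//.
by rewrite ler_ln ?posrE ?mulr_gt0 ?powR_gt0 ?Gamma_gt0.
Qed.

(** The sums are compared term by term through the tangent to [1 / t]; the difference of logarithms
    is at most [(y - x) / (x + n)], which vanishes in the limit. *)
Lemma digamma_subgradient x y : 0 < x -> 0 < y ->
  digamma y - digamma x <= (y - x) * hurwitz 2 x.
Proof.
move=> x0 y0.
have cR : (y - x) * ((x + n%:R)^-1 + hurwitz_sum 2 x n) @[n --> \oo]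
    --> (y - x) * hurwitz 2 x.
  apply: cvgMr; rewrite -[X in _ --> X]add0r; apply: cvgD; first exact: cvg_addrnV.
  exact: cvg_hurwitz.
have cL : digamma_seq y n - digamma_seq x n @[n --> \oo] --> digamma y - digamma x.
  by apply: cvgB; exact: cvg_digamma.
apply: (ler_cvg_to cL cR); apply: nearW => n; rewrite /digamma_seq.
have E k : y + k%:R - (x + k%:R) = y - x by rewrite opprD addrACA subrr addr0.
have h1 := ln_sub_le (addrn_gt0 n x0) (addrn_gt0 n y0); rewrite E in h1.
suff : hurwitz_sum 1 x n - hurwitz_sum 1 y n <= (y - x) * hurwitz_sum 2 x n.
  by lra.
rewrite -sumrB mulr_sumr; apply: ler_sum => k _.
have := exprVn_ge_tangent 1 (addrn_gt0 k x0) (addrn_gt0 k y0).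
by rewrite E mul1r lerNl opprB.
Qed.

Lemma digamma_continuous x : 0 < x -> {for x, continuous digamma}.
Proof.
move=> x0.
have h : {for x, continuous (fun y => - digamma y)}.
  apply: (@subgradient_continuous _ _ (hurwitz 2)) => //.
  - by move=> a a0; rewrite ltW// hurwitz_gt0.
  - by move=> a b a0 ab; rewrite hurwitz_nincr.
  - by move=> a b a0 b0; have := digamma_subgradient a0 b0; lra.
have -> : digamma = (fun y => - - digamma y) by apply/funext => y; rewrite opprK.
by apply: cvgN; exact: h.
Qed.

Lemma is_derive_digamma x : 0 < x -> is_derive x 1 digamma (hurwitz 2 x).
Proof.
move=> x0.
have h : is_derive x 1 (fun y => - digamma y) (- hurwitz 2 x).
  apply: (@subgradient_is_derive _ _ (fun y => - hurwitz 2 y)) => //.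
    by move=> a b a0 b0; have := digamma_subgradient a0 b0; lra.
  by apply: cvgN; exact: hurwitz_continuous.
rewrite -[hurwitz 2 x]opprK (_ : digamma = fun y => - - digamma y).
  exact: is_deriveN.
by apply/funext => y; rewrite opprK.
Qed.

Lemma near_gt0 x : 0 < x -> \forall y \near x, 0 < y.
Proof. by move=> x0; exact: lt_nbhsr. Qed.

(** Near [x], Gamma is [exp (ln Gamma)], so its derivative comes from that of [ln Gamma] without
    differentiating under the integral. *)
Lemma is_derive_Gamma x : 0 < x -> is_derive x 1 Gamma (Gamma x * digamma x).
Proof.
move=> x0.
have hL : is_derive x 1 (fun y => ln (Gamma y)) (digamma x).
  apply: subgradient_is_derive => //; first exact: ln_Gamma_subgradient.
  exact: digamma_continuous.
apply: (@near_eq_is_derive _ _ _ (fun y => expR (ln (Gamma y)))).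
  near=> y; rewrite lnK// posrE Gamma_gt0//.
  by near: y; exact: near_gt0.
by apply: is_derive_eq; rewrite lnK// posrE Gamma_gt0.
Unshelve. all: by end_near. Qed.

Lemma psi_digamma x : 0 < x -> psi x = digamma x.
Proof.
move=> x0; rewrite /psi derive1E; have [_ ->] := is_derive_Gamma x0.
by rewrite mulrC mulKf// gt_eqF// Gamma_gt0.
Qed.

(** The closed form holds at positive arguments only, so each differentiation replaces the function
    by its closed form in a neighbourhood of [x]. *)
Lemma polygammaE n x : 0 < x ->
  polygamma n.+1 x = (-1) ^+ n * n.+1`!%:R * hurwitz n.+2 x.
Proof.
elim: n x => [|n IH] x x0.
  rewrite /polygamma derive1n1 expr0 !mul1r derive1E.
  have [_ <-] := is_derive_digamma x0; apply: near_eq_derive.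
  near=> y; apply: psi_digamma; near: y; exact: near_gt0.
rewrite /polygamma derive1nS derive1E.
rewrite (@near_eq_derive _ _ _ _
  (fun y => ((-1) ^+ n * n.+1`!%:R) *: hurwitz n.+2 y)); last first.
  near=> y; apply: IH; near: y; exact: near_gt0.
have [d e] := is_derive_hurwitz n x0.
rewrite deriveZ// e /GRing.scale/= [in RHS]factS natrM exprS; ring.
Unshelve. all: by end_near. Qed.

Lemma polygamma_normE n x : 0 < x ->
  `|polygamma n.+1 x| = n.+1`!%:R * hurwitz n.+2 x.
Proof.
move=> x0; rewrite polygammaE// !normrM normrX normrN1 expr1n mul1r normr_nat.
by rewrite gtr0_norm// hurwitz_gt0.
Qed.

End Digamma.

(** * Sums compared with telescoping sums *)

Section HurwitzInequalities.
Context {R : realType}.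
Implicit Types (a p q x y alpha beta : R) (n s : nat).

Lemma mul_exprVnS a s : a != 0 -> a * a ^- s.+1 = a ^- s.
Proof. by move=> a0; rewrite exprS invfM mulrA mulfV ?mul1r. Qed.

Lemma mul_hurwitz_lt n x : 0 < x -> x * hurwitz n.+3 x < hurwitz n.+2 x.
Proof.
move=> x0; rewrite -subr_gt0.
have cL : hurwitz_sum n.+2 x N - x * hurwitz_sum n.+3 x N @[N --> \oo]
    --> hurwitz n.+2 x - x * hurwitz n.+3 x.
  by apply: cvgB; [|apply: cvgMr]; exact: cvg_hurwitz.
(* This is the term [k = 1] of the difference, a fixed positive lower bound that keeps the
   inequality strict in the limit. *)
apply: (@lt_le_trans _ _ ((x + 1) ^- n.+3)).
  by rewrite invr_gt0 exprn_gt0// addr_gt0.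
apply: (cvgr_to_ge cL); exists 2%N => // -[|[|N]] // _ /=.
have termE k : (x + k%:R) ^- n.+2 - x * (x + k%:R) ^- n.+3 = k%:R * (x + k%:R) ^- n.+3.
  by rewrite -(mul_exprVnS n.+2 (addrn_neq0 k x0)); move: (_ ^- _) => u; ring.
rewrite /hurwitz_sum mulr_sumr -sumrB; under eq_bigr do rewrite termE.
rewrite !big_ord_recl/= mul0r add0r mul1r lerDl; apply: sumr_ge0 => k _.
by rewrite mulr_ge0// invr_ge0 exprn_ge0// ltW// addrn_gt0.
Qed.

(* Convexity of [a ^- m] bounds the [k]-th term of the difference below by
   [(k + 1) / a_k ^ m - k / a_(k-1) ^ m], which telescopes. *)
Lemma hurwitz_lt_mul n x : 0 < x ->
  n.+1%:R * hurwitz n.+2 x < n.+2%:R * x * hurwitz n.+3 x.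
Proof.
move=> x0; rewrite -subr_gt0.
have cL : n.+2%:R * x * hurwitz_sum n.+3 x N - n.+1%:R * hurwitz_sum n.+2 x N
    @[N --> \oo] --> n.+2%:R * x * hurwitz n.+3 x - n.+1%:R * hurwitz n.+2 x.
  by apply: cvgB; apply: cvgMr; exact: cvg_hurwitz.
(* [e] is the strict convexity gap between the first two points; it survives the limit. *)
pose m := n.+2; pose e := x ^- m - (x + 1) ^- m - m%:R * (x + 1) ^- m.+1.
have e0 : 0 < e.
  have x10 : 0 < x + 1 by rewrite addr_gt0.
  have := @exprVn_gt_tangent R n.+1 (x + 1) x x10 x0.
  rewrite -subr_eq0 addrAC subrr add0r oner_eq0 => /(_ isT).
  by rewrite opprD addrA subrr sub0r mulrN1 mulNr opprK /e -subr_gt0.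
apply: (lt_le_trans e0); apply: (cvgr_to_ge cL); exists 2%N => // -[|[|N]] // _ /=.
pose t k := (x + k%:R) ^- m - m%:R * k%:R * (x + k%:R) ^- m.+1.
have termE k : n.+2%:R * x * (x + k%:R) ^- n.+3 - n.+1%:R * (x + k%:R) ^- n.+2 = t k.
  rewrite /t /m -(mul_exprVnS n.+2 (addrn_neq0 k x0)) -[n.+2%:R]natr1.
  by move: (_ ^- _) (n.+1%:R : R) => u v; ring.
rewrite /hurwitz_sum !mulr_sumr -sumrB; under eq_bigr do rewrite termE.
suff : e + N.+2%:R * (x + N.+1%:R) ^- m <= \sum_(i < N.+2) t i.
  by apply: le_trans; rewrite lerDl mulr_ge0// invr_ge0 exprn_ge0// ltW// addrn_gt0.
elim: N => [|N IH].
  rewrite !big_ord_recr big_ord0 /= /t /e mulr0 mul0r subr0 !addr0 add0r mulr1.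
  by move: (x ^- m) ((x + 1) ^- m) ((x + 1) ^- m.+1) => u v w; lra.
rewrite big_ord_recr/=; apply: le_trans (lerD IH (lexx _)).
have := exprVn_step_le n.+1 N.+1 x0; rewrite -/m /t.
move: ((x + N.+1%:R) ^- m) ((x + N.+2%:R) ^- m) ((x + N.+2%:R) ^- m.+1) => u v w h.
have := ler_wpM2l (ler0n R N.+2) h; rewrite -[N.+3%:R]natr1.
move: (N.+2%:R) (m%:R) => k c; lra.
Qed.

(** A division-free trapezoid rule, meant for [p = 1 / a] and [q = 1 / (a + 1)]. The base case is
    [(p - q) ^ 3 > 0]; the induction step multiplies by [p + q]. *)
Lemma exprn_trapezoid p q s : 0 < q -> q < p ->
  2 * (p * q) * (p ^+ s.+1 - q ^+ s.+1) <
    s.+1%:R * (p - q) * (p ^+ s.+2 + q ^+ s.+2).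
Proof.
move=> q0 qp; have p0 := lt_trans q0 qp; have pq : 0 < p - q by rewrite subr_gt0.
elim: s => [|s IH].
  rewrite !expr1 !expr2; have : 0 < (p - q) ^+ 3 by rewrite exprn_gt0.
  by rewrite !exprS expr0; lra.
have h : 0 <= (p - q) * (p ^+ s.+2 - q ^+ s.+2).
  by rewrite mulr_ge0 ?(ltW pq)// subr_ge0 lerXn2r ?nnegrE ?ltW.
have h1 := mulr_ge0 (ltW pq) h.
have h2 : 0 <= s.+1%:R * ((p - q) * ((p - q) * (p ^+ s.+2 - q ^+ s.+2))).
  by rewrite mulr_ge0.
have pq0 : 0 < p + q by rewrite addr_gt0.
move: IH; rewrite -(ltr_pM2l pq0) -[s.+2%:R]natr1.
rewrite ![_ ^+ s.+3]exprS ![_ ^+ s.+2]exprS in h h1 h2 *.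
move: (p ^+ s.+1) (q ^+ s.+1) (s.+1%:R) h h1 h2 => P Q c h h1 h2.
lra.
Qed.

(** For [p = 1 / a] and [q = 1 / (a + 1)] one has [p q = p - q], a factor that then cancels from the
    polynomial inequality. *)
Lemma exprVn_trapezoid a s : 0 < a ->
  a ^- s.+1 - (a + 1) ^- s.+1 < s.+1%:R * (a ^- s.+2 + (a + 1) ^- s.+2) / 2.
Proof.
move=> a0; have a10 : 0 < a + 1 by rewrite addr_gt0.
have q0 : 0 < (a + 1)^-1 by rewrite invr_gt0.
have qp : (a + 1)^-1 < a^-1 by rewrite ltf_pV2 ?posrE// ltrDl.
have pq : a^-1 * (a + 1)^-1 = a^-1 - (a + 1)^-1.
  by field; rewrite !gt_eqF.
have := exprn_trapezoid s q0 qp; rewrite pq.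
have -> : 2 * (a^-1 - (a + 1)^-1) * (a^-1 ^+ s.+1 - (a + 1)^-1 ^+ s.+1) =
  (a^-1 - (a + 1)^-1) * (2 * (a^-1 ^+ s.+1 - (a + 1)^-1 ^+ s.+1)) by ring.
rewrite [s.+1%:R * (_ - _)]mulrC -[X in _ < X]mulrA ltr_pM2l ?subr_gt0// !exprVn.
lra.
Qed.

(* Summing the trapezoid bound for [\int_a^(a+1) m / t ^ (m + 1)] with weights
   [k + 1] telescopes with boundary term [k (g_k / 2 + G_k)], where
   [G = a ^- m] and [g = m a ^- (m + 1)]. *)
Lemma hurwitz_gt_mul_sub_half n y : 0 < y ->
  n.+2%:R * (y - 1 / 2) * hurwitz n.+3 y < n.+1%:R * hurwitz n.+2 y.
Proof.
move=> y0; rewrite -subr_gt0; pose m := n.+2.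
(* [r] tends to 0, so adding it leaves the limit unchanged, and it dominates the boundary term
   [T]. *)
pose r N := m%:R / 2 * (y + N%:R) ^- m + (y + N%:R) ^- n.+1.
have cL : n.+1%:R * hurwitz_sum n.+2 y N - n.+2%:R * (y - 1 / 2) * hurwitz_sum n.+3 y N
    + r N @[N --> \oo]
    --> n.+1%:R * hurwitz n.+2 y - n.+2%:R * (y - 1 / 2) * hurwitz n.+3 y.
  rewrite -[X in _ --> X]addr0; apply: cvgD.
    by apply: cvgB; apply: cvgMr; exact: cvg_hurwitz.
  rewrite -[X in _ --> X]addr0; apply: cvgD; last exact: cvg_addrnXV.
  by rewrite -[X in _ --> X](mulr0 (m%:R / 2)); apply: cvgMr; exact: cvg_addrnXV.
pose G k := (y + k%:R) ^- m; pose g k := m%:R * (y + k%:R) ^- m.+1.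
pose T k := k%:R * (g k / 2 + G k).
have trap k : G k - G k.+1 < (g k + g k.+1) / 2.
  have := exprVn_trapezoid n.+1 (addrn_gt0 k y0).
  by rewrite -addrA natr1 /G /g -/m; lra.
pose e := (g 0 + g 1) / 2 - G 0 + G 1.
have e0 : 0 < e by have := trap 0%N; rewrite /e; lra.
apply: (lt_le_trans e0); apply: (cvgr_to_ge cL); exists 1%N => // -[|N] // _ /=.
pose w k := (k%:R + 1 / 2) * g k - G k.
have termE k : n.+1%:R * (y + k%:R) ^- n.+2 -
    n.+2%:R * (y - 1 / 2) * (y + k%:R) ^- n.+3 = w k.
  rewrite /w /G /g /m -(mul_exprVnS n.+2 (addrn_neq0 k y0)) -[n.+2%:R]natr1.
  by move: (_ ^- _) (n.+1%:R : R) => u v; field.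
rewrite /hurwitz_sum !mulr_sumr -sumrB; under eq_bigr do rewrite termE.
have Tr : T N.+1 <= r N.+1.
  rewrite /T /r /g /G; have yN := addrn_gt0 N.+1 y0.
  set b := y + N.+1%:R in yN *.
  have Nb : N.+1%:R <= b by rewrite lerDr ltW.
  have le s : N.+1%:R * b ^- s.+1 <= b ^- s.
    by rewrite -(mul_exprVnS s (lt0r_neq0 yN)) ler_pM2r// invr_gt0 exprn_gt0.
  have m20 : 0 <= m%:R / 2 :> R by rewrite divr_ge0.
  by have := ler_wpM2l m20 (le m); have := le n.+1; rewrite -/m; lra.
suff : e - T N.+1 <= \sum_(i < N.+1) w i by lra.
elim: N {Tr} => [|N IH].
  by rewrite big_ord_recr big_ord0 /= /e /T /w; lra.
rewrite big_ord_recr/=; have := trap N.+1; rewrite /T /w in IH *.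
move: IH; rewrite -[N.+2%:R]natr1.
move: (G N.+1) (G N.+2) (g N.+1) (g N.+2) => G1 G2 g1 g2 IH h.
have := ler_wpM2l (addr_ge0 (ler0n R N.+1) ler01) (ltW h).
by move: (N.+1%:R : R) IH => k; lra.
Qed.

Lemma hurwitz_gt_mul_sub n y beta : 0 < y -> 1 / 2 <= beta ->
  n.+2%:R * (y - beta) * hurwitz n.+3 y < n.+1%:R * hurwitz n.+2 y.
Proof.
move=> y0 b2; apply: le_lt_trans (hurwitz_gt_mul_sub_half n y0).
by rewrite ler_pM2r ?hurwitz_gt0// ler_pM2l// lerD2l lerN2.
Qed.

End HurwitzInequalities.

(** * Monotonicity of a power times a shifted series, and necessary conditions *)

Section PowerHurwitz.
Context {R : realType}.
Implicit Types (x y alpha beta : R) (n : nat).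

(** For [x + beta > 0] this is the function of the theorem for [i = n.+1], without the factor
    [n.+1!]. *)
Definition powR_hurwitz alpha beta n x : R := x `^ alpha * hurwitz n.+2 (x + beta).

Lemma is_derive_powR_hurwitz alpha beta n x : 0 <= beta -> 0 < x ->
  is_derive x 1 (powR_hurwitz alpha beta n) (x `^ (alpha - 1) *
    (alpha * hurwitz n.+2 (x + beta) - n.+2%:R * x * hurwitz n.+3 (x + beta))).
Proof.
move=> b0 x0; have xb0 : 0 < x + beta by rewrite ltr_pwDl.
have h1 : is_derive x 1 (fun y : R => y `^ alpha) (alpha * x `^ (alpha - 1)).
  exact: is_derive1_powR.
have h2 : is_derive x 1 (fun y => hurwitz n.+2 (y + beta))
    (- (n.+2%:R * hurwitz n.+3 (x + beta))).
  have h := is_derive_hurwitz n xb0.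
  have h' : is_derive x 1 (fun y : R => y + beta) 1.
    by apply: is_derive_eq; rewrite addr0.
  by have := @is_derive1_comp _ _ (fun y : R => y + beta) _ _ _ h h'; rewrite mulr1.
have e : x `^ alpha = x * x `^ (alpha - 1).
  by rewrite -[X in X * _](powRr1 (ltW x0)) -powRD ?(gt_eqF x0) ?implybT// subrKC.
apply: is_derive_eq; rewrite /GRing.scale/= e; ring.
Qed.

Lemma gt0_derive_incr (f df : R -> R) : (forall x, 0 < x -> is_derive x 1 f (df x)) ->
  (forall x, 0 < x -> 0 < df x) -> strictly_increasing_on `]0, +oo[ f.
Proof.
move=> fdf df0 x y; rewrite !in_itv/= !andbT => x0 _ xy.
have [||z] := @MVT _ f df x y xy.
- move=> z; rewrite in_itv/= => /andP[xz _]; exact: fdf (lt_trans x0 xz).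
- apply: derivable_within_continuous => z; rewrite in_itv/= => /andP[xz _].
  by case: (fdf _ (lt_le_trans x0 xz)).
rewrite in_itv/= => /andP[xz _] e.
by rewrite -subr_gt0 e mulr_gt0 ?subr_gt0 ?df0 ?(lt_trans x0).
Qed.

Lemma lt0_derive_decr (f df : R -> R) : (forall x, 0 < x -> is_derive x 1 f (df x)) ->
  (forall x, 0 < x -> df x < 0) -> strictly_decreasing_on `]0, +oo[ f.
Proof.
move=> fdf df0 x y x0 y0 xy.
rewrite -ltrN2; apply: (@gt0_derive_incr (fun x => - f x) (fun x => - df x)) => //.
  by move=> z z0; apply: is_deriveN; exact: fdf.
by move=> z z0; rewrite oppr_gt0 df0.
Qed.

Lemma powR_hurwitz_incr alpha beta n : 0 <= beta ->
  (forall x, 0 < x -> n.+2%:R * x * hurwitz n.+3 (x + beta)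
    < alpha * hurwitz n.+2 (x + beta)) ->
  strictly_increasing_on `]0, +oo[ (powR_hurwitz alpha beta n).
Proof.
move=> b0 h; apply: gt0_derive_incr => x x0; first exact: is_derive_powR_hurwitz.
by rewrite mulr_gt0 ?powR_gt0// subr_gt0 h.
Qed.

Lemma powR_hurwitz_decr alpha beta n : 0 <= beta ->
  (forall x, 0 < x -> alpha * hurwitz n.+2 (x + beta)
    < n.+2%:R * x * hurwitz n.+3 (x + beta)) ->
  strictly_decreasing_on `]0, +oo[ (powR_hurwitz alpha beta n).
Proof.
move=> b0 h; apply: lt0_derive_decr => x x0; first exact: is_derive_powR_hurwitz.
by rewrite pmulr_rlt0 ?powR_gt0// subr_lt0 h.
Qed.

Let powR_root (c r : R) : 0 < r -> 1 <= c -> (c `^ r^-1) `^ r = c.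
Proof.
by move=> r0 c1; rewrite -powRrM mulVf ?gt_eqF// powRr1// (le_trans ler01).
Qed.

Let powRV_gt1 (c r : R) : 0 < r -> 1 < c -> 1 < c `^ r^-1.
Proof.
move=> r0 c1; rewrite /powR gt_eqF ?(lt_trans ltr01)// expR_gt1.
by rewrite mulr_gt0 ?invr_gt0// ln_gt0.
Qed.

Let powR_split x r p q : 0 < x -> p + q = r -> x `^ r = x `^ p * x `^ q.
Proof. by move=> x0 <-; rewrite powRD// (gt_eqF x0) implybT. Qed.

(** If [alpha < n.+2], the first term of the series makes the function at least
    [x ^ (alpha - n.+2)], unbounded near 0, although it should stay below its value at 1. *)
Lemma powR_hurwitz_incr0_ge alpha n :
  strictly_increasing_on `]0, +oo[ (powR_hurwitz alpha 0 n) -> n.+2%:R <= alpha.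
Proof.
move=> inc; rewrite leNgt; apply/negP => an.
set r := n.+2%:R - alpha; have r0 : 0 < r by rewrite subr_gt0.
set f1 := powR_hurwitz alpha 0 n 1.
have f10 : 0 < f1 by rewrite /f1 /powR_hurwitz powR1 mul1r hurwitz_gt0 ?addr0.
pose c := 1 + f1; have c1 : 1 < c by rewrite ltrDl.
have c0 : 0 < c by exact: lt_trans c1.
(* [x] solves [x ^ (- r) = c], with [c] above the value at 1. *)
pose x := (c `^ r^-1)^-1; have x0 : 0 < x by rewrite invr_gt0 powR_gt0.
have x1 : x < 1.
  by rewrite invf_lt1 ?powR_gt0// powRV_gt1.
have := inc x 1; rewrite !in_itv/= x0 ltr01 => /(_ isT isT x1); apply/negP.
rewrite -leNgt -/f1 /powR_hurwitz addr0.
apply: (@le_trans _ _ (x `^ alpha * x ^- n.+2)); last first.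
  by rewrite ler_wpM2l ?powR_ge0// hurwitz_ge_exprVn.
rewrite -powR_invn ?(ltW x0)// -(powR_split x0 (_ : _ = - r)); last by rewrite /r opprB.
rewrite powRN /x -[(c `^ _)^-1]powR_inv1 ?powR_ge0// -powRrM mulN1r powRN invrK.
by rewrite powR_root ?(ltW c1)// lerDr.
Qed.

(** If [alpha > n.+1], the function is at least [x ^ (alpha - n.+1) / n.+1], unbounded at
    infinity. *)
Lemma powR_hurwitz_decr0_le alpha n :
  strictly_decreasing_on `]0, +oo[ (powR_hurwitz alpha 0 n) -> alpha <= n.+1%:R.
Proof.
move=> dec; rewrite leNgt; apply/negP => an.
set r := alpha - n.+1%:R; have r0 : 0 < r by rewrite subr_gt0.
set f1 := powR_hurwitz alpha 0 n 1.
have f10 : 0 < f1 by rewrite /f1 /powR_hurwitz powR1 mul1r hurwitz_gt0 ?addr0.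
pose c := 1 + n.+1%:R * f1; have c1 : 1 < c by rewrite ltrDl mulr_gt0.
have c0 : 0 < c by exact: lt_trans c1.
pose x := c `^ r^-1; have x0 : 0 < x by rewrite powR_gt0.
have x1 : 1 < x by exact: powRV_gt1.
have := dec x 1; rewrite !in_itv/= x0 ltr01 => /(_ isT isT x1); apply/negP.
rewrite -leNgt -/f1 /powR_hurwitz addr0.
apply: (@le_trans _ _ (x `^ alpha * (x ^- n.+1 / n.+1%:R))); last first.
  by rewrite ler_wpM2l ?powR_ge0// hurwitz_ge.
rewrite mulrA -powR_invn ?(ltW x0)// -(powR_split x0 (_ : _ = r))//.
by rewrite powR_root ?(ltW c1)// ler_pdivlMr// /c mulrC lerDr.
Qed.

(** If [alpha < n.+1], the function is at most [2 x ^ (alpha - n.+1)] for [x >= 1], so it falls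
    below its positive value at 1. *)
Lemma powR_hurwitz_incr_ge alpha beta n : 0 <= beta ->
  strictly_increasing_on `[0, +oo[ (powR_hurwitz alpha beta n) -> n.+1%:R <= alpha.
Proof.
move=> b0 inc; rewrite leNgt; apply/negP => an.
set r := n.+1%:R - alpha; have r0 : 0 < r by rewrite subr_gt0.
set f1 := powR_hurwitz alpha beta n 1.
have f10 : 0 < f1.
  by rewrite /f1 /powR_hurwitz powR1 mul1r hurwitz_gt0// ltr_pwDl.
(* Chosen so that [2 / c] is at most [f1]; below, [x ^ r = c]. *)
pose c := 1 + 2 / f1; have c1 : 1 < c by rewrite ltrDl divr_gt0.
have c0 : 0 < c by exact: lt_trans c1.
pose x := c `^ r^-1; have x0 : 0 < x by rewrite powR_gt0.
have x1 : 1 < x by exact: powRV_gt1.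
have := inc 1 x; rewrite !in_itv/= (ltW x0) ler01 => /(_ isT isT x1); apply/negP.
rewrite -leNgt -/f1 /powR_hurwitz.
apply: (@le_trans _ _ (x `^ alpha * (2 * x ^- n.+1))).
  rewrite ler_wpM2l ?powR_ge0//.
  apply: (@le_trans _ _ (hurwitz n.+2 x)); first by rewrite hurwitz_nincr// lerDl.
  apply: (le_trans (hurwitz_le n x0)); rewrite mulr_natl mulr2n lerD//.
    by rewrite lef_pV2 ?posrE ?exprn_gt0// ler_weXn2l// ltW.
  by rewrite ler_piMr ?invr_ge0 ?exprn_ge0 ?(ltW x0)// invf_le1// ler1n.
rewrite mulrCA -powR_invn ?(ltW x0)//.
rewrite -(powR_split x0 (_ : _ = - r)); last by rewrite /r opprB.
rewrite powRN powR_root ?(ltW c1)// ler_pdivrMr// /c mulrDr mulr1.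
by rewrite mulrCA divff ?gt_eqF// mulr1 lerDr ltW.
Qed.

End PowerHurwitz.

(** * The function delta *)

Section Delta.
Context {R : realType}.
Implicit Types (s t tau beta : R).

Lemma expR_sub1_gt0 t : 0 < t -> 0 < expR t - 1.
Proof. by move=> t0; rewrite subr_gt0 expR_gt1. Qed.

Lemma expR_sub1_le t : expR t - 1 <= t * expR t.
Proof.
have := expR_ge1Dx (- t); have e0 := expR_gt0 t.
rewrite expRN -(ler_pM2r e0) mulVf ?gt_eqF//; lra.
Qed.

Lemma expR_sub1_lt t : t != 0 -> expR t - 1 < t * expR t.
Proof.
move=> t0; have := @expR_gt1Dx R (- t); rewrite oppr_eq0 => /(_ t0).
have e0 := expR_gt0 t; rewrite expRN -(ltr_pM2r e0) mulVf ?gt_eqF//; lra.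
Qed.

Lemma ge0_derive_ge (f df : R -> R) t : 0 < t ->
  (forall x : R, is_derive x 1 f (df x)) ->
  (forall x, 0 < x -> 0 <= df x) -> f 0 <= f t.
Proof.
move=> t0 fdf df0; have cf : {within `[0, t], continuous f}.
  by apply: derivable_within_continuous => z _; case: (fdf z).
have [z] := @MVT _ f df 0 t t0 (fun z _ => fdf z) cf.
rewrite in_itv/= => /andP[z0 _] e.
by rewrite -subr_ge0 e mulr_ge0 ?df0// subr0 ltW.
Qed.

Lemma gt0_derive_gt (f df : R -> R) t : 0 < t ->
  (forall x : R, is_derive x 1 f (df x)) ->
  (forall x, 0 < x -> 0 < df x) -> f 0 < f t.
Proof.
move=> t0 fdf df0; have cf : {within `[0, t], continuous f}.
  by apply: derivable_within_continuous => z _; case: (fdf z).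
have [z] := @MVT _ f df 0 t t0 (fun z _ => fdf z) cf.
rewrite in_itv/= => /andP[z0 _] e.
by rewrite -subr_gt0 e mulr_gt0 ?df0// subr0.
Qed.

Lemma delta_deriv_num_gt0 t : 0 < t -> 0 < (t - 2) * expR t + t + 2.
Proof.
move=> t0; have -> : 0 = ((0 : R) - 2) * expR 0 + 0 + 2 by rewrite expR0; ring.
apply: (@gt0_derive_gt (fun t => (t - 2) * expR t + t + 2)
  (fun t => (t - 1) * expR t + 1)) => //.
  by move=> x; apply: is_derive_eq; rewrite /GRing.scale/=; ring.
by move=> x x0; have := @expR_sub1_lt x (lt0r_neq0 x0); lra.
Qed.

Lemma delta_num_ge t : 0 < t -> t ^+ 2 / 2 <= expR t * (t - 1) + 1.
Proof.
move=> t0; rewrite -subr_ge0.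
have -> : 0 = expR 0 * ((0 : R) - 1) + 1 - 0 ^+ 2 / 2.
  by rewrite expR0 expr0n /=; ring.
apply: (@ge0_derive_ge (fun t => expR t * (t - 1) + 1 - t ^+ 2 / 2)
  (fun t => t * (expR t - 1))) => //.
  by move=> x; apply: is_derive_eq; rewrite /GRing.scale/= ?expr1; field.
by move=> x x0; rewrite mulr_ge0 ?(ltW x0)// ltW// expR_sub1_gt0.
Qed.

Lemma is_derive_delta t : 0 < t -> is_derive t 1 delta
  (- (expR t * ((t - 2) * expR t + t + 2)) / (expR t - 1) ^+ 3).
Proof.
move=> t0; have e0 := lt0r_neq0 (expR_sub1_gt0 t0).
have hN : is_derive t 1 (fun t : R => expR t * (t - 1) + 1) (t * expR t).
  by apply: is_derive_eq; rewrite /GRing.scale/=; ring.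
have hD : is_derive t 1 (fun t : R => (expR t - 1) ^+ 2) (2 * (expR t - 1) * expR t).
  by apply: is_derive_eq; rewrite /GRing.scale/= ?expr1; ring.
have D0 : (expR t - 1) ^+ 2 != 0 by rewrite expf_neq0.
have hV := @is_deriveV R (fun t : R => (expR t - 1) ^+ 2) t _ 1 D0 hD.
apply: is_derive_eq.
by rewrite /GRing.scale/=; field.
Qed.

Lemma delta_decr : strictly_decreasing_on `]0, +oo[ (@delta R).
Proof.
apply: lt0_derive_decr is_derive_delta _ => t t0.
rewrite mulNr oppr_lt0 divr_gt0 ?exprn_gt0 ?expR_sub1_gt0//.
by rewrite mulr_gt0 ?expR_gt0 ?delta_deriv_num_gt0.
Qed.

(** This bound tends to 1/2 at 0, and the next one to 0 at infinity; together they give explicit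
    points on either side of any value in ]0, 1/2[. *)
Lemma delta_ge t : 0 < t -> expR (- (2 * t)) / 2 <= delta t.
Proof.
move=> t0; have e0 := expR_sub1_gt0 t0; have E0 := expR_gt0 t.
rewrite /delta ler_pdivlMr ?exprn_gt0//.
apply: le_trans (delta_num_ge t0).
have h : (expR t - 1) ^+ 2 <= (t * expR t) ^+ 2.
  by rewrite lerXn2r ?nnegrE ?expR_sub1_le ?mulr_ge0 ?ltW.
have c0 : 0 <= expR (- (2 * t)) / 2 :> R by rewrite divr_ge0 ?expR_ge0.
apply: (le_trans (ler_wpM2l c0 h)).
rewrite expRN expRM_natl le_eqVlt; apply/orP; left; apply/eqP.
by field; rewrite gt_eqF.
Qed.

Lemma delta_le t : 0 < t -> delta t <= 2 / t.
Proof.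
move=> t0; have e0 := expR_sub1_gt0 t0.
apply: (@le_trans _ _ (t / (expR t - 1))).
  rewrite /delta ler_pdivrMr ?exprn_gt0// expr2 mulrA divfK ?gt_eqF//.
  by have := expR_ge1Dx t; lra.
rewrite ler_pdivrMr// mulrAC ler_pdivlMr// -expr2.
by have := @expR_ge1Dxn R t 1 (ltW t0); rewrite /factorial/=; lra.
Qed.

Lemma delta_invP beta : 0 < beta -> beta < 1 / 2 ->
  0 < delta_inv beta /\ delta (delta_inv beta) = beta.
Proof.
move=> b0 b2.
(* The solutions of [exp (- 2 a) / 2 = beta] and [2 / b = beta]: they bracket [beta] for the
   intermediate value theorem. *)
pose a := - (ln (2 * beta) / 2); pose b := 2 / beta.
have lb : ln (2 * beta) < 0 by apply: ln_lt0; apply/andP; split; lra.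
have a0 : 0 < a by rewrite /a; lra.
have bp : 0 < b by rewrite divr_gt0.
have da : beta <= delta a.
  apply: le_trans (delta_ge a0).
  have -> : - (2 * a) = ln (2 * beta) by rewrite /a; field.
  by rewrite lnK ?posrE; lra.
have db : delta b <= beta.
  apply: (le_trans (delta_le bp)); rewrite /b invf_div mulrCA divff// mulr1//.
have ab : a <= b.
  rewrite leNgt; apply/negP => ba.
  have := delta_decr; rewrite /strictly_decreasing_on => /(_ a b).
  rewrite !in_itv/= !andbT => /(_ a0 bp ba) h.
  by have := lt_le_trans (le_lt_trans da h) db; rewrite ltxx.
have cd : {within `[a, b], continuous (@delta R)}.
  apply: derivable_within_continuous => t; rewrite in_itv/= => /andP[at_ _].
  by case: (is_derive_delta (lt_le_trans a0 at_)).
have [|c] := @IVT R delta a b beta ab cd.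
  by rewrite ge_min le_max da db orbT.
rewrite in_itv/= => /andP[ac _] dc.
have c0 := lt_le_trans a0 ac.
suff -> : delta_inv beta = c by [].
(* Strict monotonicity makes [delta] injective on positive reals, so the partial inverse returns
   [c]. *)
rewrite -dc; apply: pinvKV; last by rewrite inE.
move=> s t; rewrite !inE/= => s0 t0 st.
have [ts|ts|//] := ltgtP s t.
  by have := @delta_decr t s; rewrite !in_itv/= s0 t0 st ltxx => /(_ isT isT ts).
by have := @delta_decr s t; rewrite !in_itv/= s0 t0 st ltxx => /(_ isT isT ts).
Qed.

Definition delta_pot beta t : R := t * (beta + (expR t - 1)^-1).

Lemma is_derive_delta_pot beta t : 0 < t ->
  is_derive t 1 (delta_pot beta) (beta - delta t).
Proof.
move=> t0; have e0 := lt0r_neq0 (expR_sub1_gt0 t0).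
have hD : is_derive t 1 (fun t : R => expR t - 1) (expR t).
  by apply: is_derive_eq; ring.
have hV := @is_deriveV R (fun t : R => expR t - 1) t _ 1 e0 hD.
have hB : is_derive t 1 (fun t : R => beta + (expR t - 1)^-1)
    (- (expR t - 1) ^- 2 * expR t).
  by apply: is_derive_eq; rewrite /GRing.scale/=; ring.
by apply: is_derive_eq; rewrite /GRing.scale/= /delta; field.
Qed.

Lemma delta_pot_MVT beta s t : 0 < s -> s < t ->
  exists2 c, s < c < t &
    delta_pot beta t - delta_pot beta s = (beta - delta c) * (t - s).
Proof.
move=> s0 st.
have [||z zst e] := @MVT R (delta_pot beta) (fun t => beta - delta t) s t st.
- move=> z; rewrite in_itv/= => /andP[sz _].
  exact: is_derive_delta_pot (lt_trans s0 sz).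
- apply: derivable_within_continuous => z; rewrite in_itv/= => /andP[sz _].
  by case: (is_derive_delta_pot beta (lt_le_trans s0 sz)).
by exists z => //; move: zst; rewrite in_itv.
Qed.

Lemma delta_pot_incr tau s t : 0 < tau -> tau <= s -> s < t ->
  delta_pot (delta tau) s < delta_pot (delta tau) t.
Proof.
move=> tau0 taus st; have s0 := lt_le_trans tau0 taus.
have [c /andP[sc _] e] := delta_pot_MVT (delta tau) s0 st.
rewrite -subr_gt0 e mulr_gt0 ?subr_gt0//; apply: delta_decr.
- by rewrite in_itv/= andbT (lt_trans s0).
- by rewrite in_itv/= andbT.
- exact: le_lt_trans sc.
Qed.

(** The derivative is [delta tau - delta t], negative before [tau] and positive after it because
    [delta] decreases. *)
Lemma delta_pot_min tau t : 0 < tau -> 0 < t ->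
  delta_pot (delta tau) tau <= delta_pot (delta tau) t.
Proof.
move=> tau0 t0; have [tt|tt|->//] := ltgtP tau t.
  by rewrite ltW// delta_pot_incr.
have [c /andP[tc ct] e] := delta_pot_MVT (delta tau) t0 tt.
rewrite -subr_le0 e mulr_le0_ge0 ?subr_ge0 ?subr_le0 ?(ltW tt)// ltW//.
apply: delta_decr => //; first by rewrite in_itv/= andbT.
by rewrite in_itv/= andbT (lt_trans t0).
Qed.

End Delta.

(** * The Laplace integral for beta < 1/2 *)

Section LaplaceSeries.
Context {R : realType}.
Notation mu := (@lebesgue_measure R).
Implicit Types (t x y beta tau : R) (n k N : nat).

Local Notation D := (`]0%R, +oo[%classic : set (measurableTypeR R)).

Lemma laplace_powD p x y t :
  laplace_pow p (x + y) t = laplace_pow p x t * expR (- (y * t)).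
Proof. by rewrite /laplace_pow mulrDl opprD expRD mulrA. Qed.

Lemma laplace_powDn p y k t :
  laplace_pow p (y + k%:R) t = laplace_pow p y t * expR (- t) ^+ k.
Proof. by rewrite laplace_powD -expRM_natl mulrN. Qed.

(** Monotone convergence: the terms are nonnegative, and the [k]-th integrates to
    [w k * n! / (y + k) ^ n.+1]. Measurability of the limit is returned for later integral
    comparisons. *)
Lemma integral_laplace_series (w : nat -> R) (G : R -> R) n y (l : R) :
  0 < y -> (forall k, 0 <= w k) ->
  (forall t, 0 < t -> \sum_(k < N) w k * expR (- t) ^+ k @[N --> \oo] --> G t) ->
  \sum_(k < N) w k * (n`!%:R / (y + k%:R) ^+ n.+1) @[N --> \oo] --> l ->
  measurable_fun D (fun t => (laplace_pow n%:R y t * G t)%:E) /\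
  (\int[mu]_(t in D) (laplace_pow n%:R y t * G t)%:E = l%:E)%E.
Proof.
move=> y0 w0 cG cl.
pose g N t := (\sum_(k < N) w k * laplace_pow n%:R (y + k%:R) t)%:E.
have mg N : measurable_fun D (g N).
  apply/measurable_EFinP; apply: measurable_sum => k.
  by apply: measurable_funM => //; exact: measurable_laplace_pow.
have cg t : D t -> g N t @[N --> \oo] --> (laplace_pow n%:R y t * G t)%:E.
  rewrite /= in_itv/= andbT => t0; apply: cvg_EFin; first exact: nearW.
  have -> : fine \o (fun N => g N t) =
      (fun N => laplace_pow n%:R y t * \sum_(k < N) w k * expR (- t) ^+ k).
    apply/funext => N /=; rewrite mulr_sumr; apply: eq_bigr => k _.
    by rewrite laplace_powDn mulrCA.
  by apply: cvgMr; exact: cG.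
have wl k t : 0 <= w k * laplace_pow n%:R (y + k%:R) t.
  by rewrite mulr_ge0// laplace_pow_ge0.
have g0 N t : D t -> (0 <= g N t)%E by rewrite lee_fin sumr_ge0.
have gnd t : D t -> nondecreasing_seq (g ^~ t).
  move=> _; apply/nondecreasing_seqP => N; rewrite lee_fin big_ord_recr/= lerDl.
  exact: wl.
split; first exact: (emeasurable_fun_cvg g _ mg cg).
have ig N : (\int[mu]_(t in D) g N t =
    (\sum_(k < N) w k * (n`!%:R / (y + k%:R) ^+ n.+1))%:E)%E.
  rewrite /g; under eq_integral do rewrite -sumEFin.
  rewrite ge0_integral_sum//; last 2 first.
  - move=> k; apply/measurable_EFinP; apply: measurable_funM => //.
    exact: measurable_laplace_pow.
  - by move=> k t _; rewrite lee_fin wl.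
  rewrite -sumEFin; apply: eq_bigr => k _; under eq_integral do rewrite EFinM.
  rewrite ge0_integralZl ?lee_fin//.
  - by rewrite -/(laplace_int _ _) laplace_int_nat// addrn_gt0.
  - exact: measurable_laplace_powE.
  - by move=> t _; rewrite lee_fin laplace_pow_ge0.
have := @cvg_monotone_convergence _ _ _ mu D _ g mg g0 gnd.
rewrite (_ : (fun N => _) = EFin \o
  (fun N => \sum_(k < N) w k * (n`!%:R / (y + k%:R) ^+ n.+1))); last exact/funext.
move=> /(_ (measurable_itv _)) c1.
transitivity (\int[mu]_(t in D) limn (g ^~ t))%E.
  by apply: eq_integral => t /set_mem Dt; apply/esym/cvg_lim => //; exact: cg.
apply: (cvg_unique _ c1); first exact: ereal_hausdorff.
by apply: cvg_EFin; [exact: nearW|exact: cl].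
Qed.

Let zlt1 t : 0 < t -> expR (- t) < 1.
Proof. by move=> t0; rewrite expR_lt1 oppr_lt0. Qed.

(** The factor [1] matches the constant weight in [integral_laplace_series]. *)
Lemma cvg_geometric_expRN t : 0 < t ->
  \sum_(k < N) 1 * expR (- t) ^+ k @[N --> \oo] --> (1 - expR (- t))^-1.
Proof.
move=> t0; set z := expR (- t).
have z1 : z < 1 by exact: zlt1.
have c : (1 - z ^+ N) / (1 - z) @[N --> \oo] --> (1 - z)^-1.
  rewrite -[X in _ --> X]mul1r; apply: cvgMl; rewrite -[X in _ --> X]subr0.
  apply: cvgB; first exact: cvg_cst.
  by apply: cvg_expr; rewrite ger0_norm ?expR_ge0.
move: c; rewrite (_ : (fun N => _) = fun N => \sum_(k < N) 1 * z ^+ k)//.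
apply/funext => N; under eq_bigr do rewrite mul1r.
by rewrite -opprB subrX1 -mulNr opprB mulrAC mulfV ?mul1r// subr_eq0 gt_eqF.
Qed.

Lemma cvg_mul_expRN t : 0 < t -> N%:R * expR (- t) ^+ N @[N --> \oo] --> (0 : R).
Proof.
move=> t0; rewrite -cvg_shiftS.
have := @cvg_laplace_pow R 1 t (fun n => 1 + n%:R) t0.
rewrite (_ : (fun n => laplace_pow _ _ _) = (fun n => n.+1%:R * expR (- t) ^+ n.+1)).
  by apply; [move=> n; rewrite lerDl|apply: cvg_addrnV].
apply/funext => n; rewrite -natr1 addrC /laplace_pow powRr1 ?addr_ge0//.
by rewrite -expRM_natl -natr1 mulrN addrC [t * _]mulrC.
Qed.

(** With [z = exp (- t)], the sum is [beta / (1 - z) + z / (1 - z) ^ 2], and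
    [z / (1 - z) = 1 / (exp t - 1)]. *)
Lemma cvg_arith_geometric_expRN beta t : 0 < t ->
  \sum_(k < N) (beta + k%:R) * expR (- t) ^+ k @[N --> \oo] -->
  (1 - expR (- t))^-1 * (beta + (expR t - 1)^-1).
Proof.
move=> t0; set z := expR (- t).
have z1 : z < 1 by exact: zlt1.
have zn : 1 - z != 0 by rewrite subr_eq0 gt_eqF.
have z0 : z != 0 by rewrite gt_eqF ?expR_gt0.
have -> : (expR t - 1)^-1 = z / (1 - z).
  by rewrite -[t]opprK expRN -/z; field; rewrite zn z0.
have c2 : (z - N%:R * z ^+ N * (1 - z) - z ^+ N * z) / (1 - z) ^+ 2 @[N --> \oo]
    --> z / (1 - z) ^+ 2.
  apply: cvgMl; rewrite -[X in _ --> X]subr0; apply: cvgB.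
    rewrite -[X in _ --> X]subr0; apply: cvgB; first exact: cvg_cst.
    rewrite -[X in _ --> X](mul0r (1 - z)); apply: cvgMl; exact: cvg_mul_expRN.
  rewrite -[X in _ --> X](mul0r z); apply: cvgMl.
  by apply: cvg_expr; rewrite ger0_norm ?expR_ge0.
have c1 : beta * \sum_(k < N) 1 * z ^+ k @[N --> \oo] --> beta * (1 - z)^-1.
  by apply: cvgMr; exact: cvg_geometric_expRN.
have -> : (1 - z)^-1 * (beta + z / (1 - z)) = beta * (1 - z)^-1 + z / (1 - z) ^+ 2.
  by field.
rewrite (_ : (fun N => _) = (fun N => beta * \sum_(k < N) 1 * z ^+ k +
    (z - N%:R * z ^+ N * (1 - z) - z ^+ N * z) / (1 - z) ^+ 2)).
  exact: cvgD c1 c2.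
apply/funext => N; rewrite mulr_sumr.
have -> : (z - N%:R * z ^+ N * (1 - z) - z ^+ N * z) / (1 - z) ^+ 2 =
    \sum_(k < N) k%:R * z ^+ k.
  elim: N => [|N IH]; first by rewrite big_ord0 expr0; field.
  by rewrite big_ord_recr/= -IH exprS -natr1; field.
by rewrite -big_split/=; apply: eq_bigr => k _; rewrite mulrDl mul1r.
Qed.

(* The derivative of [x ^ alpha S(x + beta)] is a Laplace integral whose density
   is a positive function times [alpha - (i + 1) + delta_pot beta t]; at
   [beta = delta tau] the minimum of [delta_pot beta] is attained at [tau]. *)
Lemma hurwitz_delta_lt n x tau : 0 < x -> 0 < tau -> 0 <= delta tau ->
  n.+2%:R * x * hurwitz n.+3 (x + delta tau) <
  (n.+2%:R - delta_pot (delta tau) tau) * hurwitz n.+2 (x + delta tau).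
Proof.
move=> x0 tau0 b0; set beta := delta tau in b0 *; set y := x + beta.
have y0 : 0 < y by rewrite ltr_pwDl.
set m := delta_pot beta tau.
have m0 : 0 <= m.
  by rewrite mulr_ge0 ?(ltW tau0)// addr_ge0// invr_ge0 ltW// expR_sub1_gt0.
pose q t : R := (1 - expR (- t))^-1.
have cA : \sum_(k < N) 1 * (n.+1`!%:R / (y + k%:R) ^+ n.+2) @[N --> \oo]
    --> n.+1`!%:R * hurwitz n.+2 y.
  rewrite (_ : (fun N => _) = (fun N => n.+1`!%:R * hurwitz_sum n.+2 y N)).
    by apply: cvgMr; exact: cvg_hurwitz.
  by apply/funext => N; rewrite mulr_sumr; apply: eq_bigr => k _; rewrite mul1r.
(* As [y = x + beta], the weight [beta + k] is [(y + k) - x], which splits each term between the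
   exponents [n.+2] and [n.+3]. *)
have cB : \sum_(k < N) (beta + k%:R) * (n.+2`!%:R / (y + k%:R) ^+ n.+3) @[N --> \oo]
    --> n.+2`!%:R * (hurwitz n.+2 y - x * hurwitz n.+3 y).
  rewrite (_ : (fun N => _) =
      (fun N => n.+2`!%:R * (hurwitz_sum n.+2 y N - x * hurwitz_sum n.+3 y N))).
    apply: cvgMr; apply: cvgB; first exact: cvg_hurwitz.
    by apply: cvgMr; exact: cvg_hurwitz.
  apply/funext => N; rewrite [x * _]mulr_sumr -sumrB mulr_sumr; apply: eq_bigr => k _.
  rewrite -(mul_exprVnS n.+2 (addrn_neq0 k y0)) mulrCA -mulrBl.
  by congr (_ * (_ * _)); rewrite /y; ring.
have bk0 k : 0 <= beta + k%:R by rewrite addr_ge0.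
have [mA iA] := integral_laplace_series y0 (fun=> ler01) cvg_geometric_expRN cA.
have [mB iB] := integral_laplace_series y0 bk0 (@cvg_arith_geometric_expRN beta) cB.
have q1 t : 0 < t -> 1 <= q t.
  by move=> t0; rewrite /q invf_ge1 ?subr_gt0 ?zlt1// gerBl expR_ge0.
(* Minimality of [m] alone gives a weak inequality. On [E], to the right of the minimizer,
   [delta_pot] exceeds [m] by at least [e]; this adds [e * c * tau] to the integral, [tau] being the
   length of [E]. *)
pose e := delta_pot beta (2 * tau) - m.
have e0 : 0 < e by rewrite subr_gt0 delta_pot_incr//; lra.
(* A lower bound for the density on [E]: the power is smallest at the left endpoint, the exponential
   at the right one. *)
pose c := (2 * tau) `^ n.+1%:R * expR (- (y * (3 * tau))) : R.
have c0 : 0 < c by rewrite mulr_gt0 ?expR_gt0 ?powR_gt0; lra.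
pose E := `[2 * tau, 3 * tau]%classic : set (measurableTypeR R).
have mE : measurable E by exact: measurable_itv.
have ptw t : D t -> (m%:E * (laplace_pow n.+1%:R y t * q t)%:E +
    (e * c)%:E * (\1_E t)%:E <=
    (laplace_pow n.+2%:R y t * (q t * (beta + (expR t - 1)^-1)))%:E)%E.
  rewrite /= in_itv/= andbT => t0.
  rewrite -!EFinM -EFinD lee_fin.
  have -> : laplace_pow n.+2%:R y t = t * laplace_pow n.+1%:R y t.
    by rewrite /laplace_pow !powR_mulrn ?(ltW t0)// exprS mulrA.
  have -> : t * laplace_pow n.+1%:R y t * (q t * (beta + (expR t - 1)^-1)) =
      delta_pot beta t * (laplace_pow n.+1%:R y t * q t) by rewrite /delta_pot; ring.
  have Lq0 : 0 <= laplace_pow n.+1%:R y t * q t.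
    by rewrite mulr_ge0 ?laplace_pow_ge0// (le_trans ler01) ?q1.
  have mt : m <= delta_pot beta t by exact: delta_pot_min.
  rewrite indicE; have [tE|tE] := boolP (t \in E); last first.
    by rewrite mulr0 addr0 ler_wpM2r.
  move: tE; rewrite inE /E/= in_itv/= => /andP[t2 t3].
  have et : e <= delta_pot beta t - m.
    rewrite lerD2r; move: t2; rewrite le_eqVlt => /predU1P[<-//|t2].
    by rewrite ltW// delta_pot_incr//; lra.
  have cL : c <= laplace_pow n.+1%:R y t * q t.
    apply: (@le_trans _ _ (laplace_pow n.+1%:R y t)); last first.
      by rewrite ler_peMr ?laplace_pow_ge0 ?q1.
    rewrite ler_pM ?powR_ge0 ?expR_ge0//.
      by rewrite ge0_ler_powR ?nnegrE ?(ltW t0)//; lra.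
    by rewrite ler_expR lerN2 ler_pM2l.
  rewrite mulr1 -lerBrDl -mulrBl.
  by rewrite ler_pM ?(ltW e0) ?(ltW c0).
have mI : measurable_fun D (fun t => (e * c)%:E * (\1_E t)%:E)%E.
  by apply: measurable_funeM; apply/measurable_EFinP; exact: measurable_indic.
have pA t : D t -> (0 <= (laplace_pow n.+1%:R y t * q t)%:E)%E.
  rewrite /= in_itv/= andbT => t0; rewrite lee_fin mulr_ge0 ?laplace_pow_ge0//.
  by rewrite (le_trans ler01) ?q1.
have pI t : (0 <= (\1_E t : R)%:E)%E by rewrite lee_fin.
have ec0 : 0 < e * c by rewrite mulr_gt0.
have iE : (\int[mu]_(t in D) (\1_E t)%:E = tau%:E)%E.
  rewrite integral_indic// setIidl.
    apply: (etrans (lebesgue_measure_itv `[2 * tau, 3 * tau])).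
    rewrite /= lte_fin ifT; first by rewrite -EFinB; congr EFin; ring.
    by lra.
  move=> t; rewrite /E/= !in_itv/= andbT => /andP[h _]; apply: lt_le_trans h.
  by rewrite mulr_gt0.
have : ((m * (n.+1`!%:R * hurwitz n.+2 y) + e * c * tau)%:E <=
    (n.+2`!%:R * (hurwitz n.+2 y - x * hurwitz n.+3 y))%:E)%E.
  rewrite EFinD [(m * _)%:E]EFinM [(e * c * _)%:E]EFinM -iA -iB -iE.
  rewrite -ge0_integralZl ?lee_fin// -ge0_integralZl ?lee_fin ?(ltW ec0)//; last first.
    by apply/measurable_EFinP; exact: measurable_indic.
  rewrite -ge0_integralD//; last 3 first.
  - by move=> t Dt; rewrite mule_ge0 ?pA.
  - by apply: measurable_funeM; exact: mA.
  - by move=> t Dt; rewrite mule_ge0 ?lee_fin ?(ltW ec0).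
  apply: ge0_le_integral => //.
  - by move=> t Dt; rewrite adde_ge0// mule_ge0 ?pA ?lee_fin ?(ltW ec0).
  - by apply: emeasurable_funD => //; apply: measurable_funeM; exact: mA.
rewrite lee_fin => h.
have {h} : m * (n.+1`!%:R * hurwitz n.+2 y) <
    n.+2`!%:R * (hurwitz n.+2 y - x * hurwitz n.+3 y).
  by apply: lt_le_trans h; rewrite ltrDl mulr_gt0.
have F0 : (0 : R) < n.+1`!%:R by rewrite ltr0n fact_gt0.
rewrite [n.+2`!]factS natrM -[n.+2%:R * _ * _]mulrA [n.+2%:R * (_ * _)]mulrCA
  [m * _]mulrCA ltr_pM2l//.
by lra.
Qed.

End LaplaceSeries.

Theorem theorem1 (R : realType) (i : nat) (alpha beta : R)
    (hi : (1 <= i)%N) (hbeta : 0 <= beta) :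
  [/\ (strictly_increasing_on `]0, +oo[
         (fun x : R => x `^ alpha * `|polygamma i x|) <-> i%:R + 1 <= alpha)
      /\ (strictly_decreasing_on `]0, +oo[
         (fun x : R => x `^ alpha * `|polygamma i x|) <-> alpha <= i%:R),
      1 / 2 <= beta ->
        (strictly_increasing_on `[0, +oo[
           (fun x : R => x `^ alpha * `|polygamma i (x + beta)|)
         <-> i%:R <= alpha)
    & 0 < beta -> beta < 1 / 2 ->
      i%:R + 1 - (expR (delta_inv beta) / (expR (delta_inv beta) - 1)
                  + beta - 1) * delta_inv beta <= alpha ->
      strictly_increasing_on `]0, +oo[
        (fun x : R => x `^ alpha * `|polygamma i (x + beta)|)].
Proof.
case: i hi => // n _.
pose F (b x : R) : R := x `^ alpha * `|polygamma n.+1 (x + b)|.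
have FE (b x : R) : 0 < x + b -> F b x = n.+1`!%:R * powR_hurwitz alpha b n x.
  by move=> xb; rewrite /F polygamma_normE// /powR_hurwitz mulrCA.
have F0E : (fun x : R => x `^ alpha * `|polygamma n.+1 x|) = F 0.
  by apply/funext => x; rewrite /F addr0.
have fact0 : 0 < n.+1`!%:R :> R by rewrite ltr0n fact_gt0.
have xb0 (b x : R) : 0 <= b -> x \in `]0, +oo[%R -> 0 < x + b.
  by move=> b0; rewrite in_itv/= andbT => x0; rewrite ltr_pwDl.
have incE b : 0 <= b -> strictly_increasing_on `]0, +oo[ (F b) <->
    strictly_increasing_on `]0, +oo[ (powR_hurwitz alpha b n).
  move=> b0; split=> h x y xI yI xy; have := h x y xI yI xy;
    by rewrite !FE ?xb0// ltr_pM2l.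
have decE b : 0 <= b -> strictly_decreasing_on `]0, +oo[ (F b) <->
    strictly_decreasing_on `]0, +oo[ (powR_hurwitz alpha b n).
  move=> b0; split=> h x y xI yI xy; have := h x y xI yI xy;
    by rewrite !FE ?xb0// ltr_pM2l.
rewrite F0E natr1; split; first split.
- rewrite incE//; split; first exact: powR_hurwitz_incr0_ge.
  move=> an; apply: powR_hurwitz_incr => // x x0; rewrite addr0.
  apply: (@lt_le_trans _ _ (n.+2%:R * hurwitz n.+2 x)).
    by rewrite -mulrA ltr_pM2l// mul_hurwitz_lt.
  by rewrite ler_wpM2r// ltW// hurwitz_gt0.
- rewrite decE//; split; first exact: powR_hurwitz_decr0_le.
  move=> an; apply: powR_hurwitz_decr => // x x0; rewrite addr0.
  apply: le_lt_trans (hurwitz_lt_mul n x0).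
  by rewrite ler_wpM2r// ltW// hurwitz_gt0.
- move=> b2; have b0 : 0 < beta by lra.
  have FE0 (x : R) : 0 <= x -> F beta x = n.+1`!%:R * powR_hurwitz alpha beta n x.
    by move=> x0; rewrite FE// ltr_wpDl.
  split=> [inc|an].
    apply: (powR_hurwitz_incr_ge hbeta) => x y xI yI xy.
    have := inc x y xI yI xy; rewrite -!/(F beta _) !FE0 ?ltr_pM2l//.
    + by move: yI; rewrite in_itv/= andbT.
    + by move: xI; rewrite in_itv/= andbT.
  have inc : strictly_increasing_on `]0, +oo[ (F beta).
    rewrite incE//; apply: powR_hurwitz_incr => // x x0.
    have y0 : 0 < x + beta by rewrite addr_gt0.
    have := hurwitz_gt_mul_sub n y0 b2; rewrite addrK => h.
    by apply: (lt_le_trans h); rewrite ler_wpM2r// ltW// hurwitz_gt0.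
  move=> x y; rewrite !in_itv/= !andbT => x0 y0 xy; rewrite -!/(F beta _).
  (* At the endpoint 0 the function vanishes, since [alpha >= n.+1 > 0] gives [0 ^ alpha = 0], and
     it is positive afterwards. *)
  move: x0; rewrite le_eqVlt => /predU1P[x0|x0]; last first.
    by apply: inc => //; rewrite in_itv/= andbT// (lt_trans x0).
  rewrite -x0 in xy *; rewrite [ltLHS]/F powR0; last first.
    by rewrite gt_eqF// (lt_le_trans _ an).
  by rewrite mul0r FE0// mulr_gt0// mulr_gt0 ?powR_gt0 ?hurwitz_gt0 ?addr_gt0.
- move=> b0 b2; have [tau0 dtau] := delta_invP b0 b2.
  set tau := delta_inv beta in tau0 dtau *.
  move=> h; rewrite -/(F beta) incE//; apply: powR_hurwitz_incr => // x x0.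
  have dt0 : 0 <= delta tau by rewrite dtau.
  have := hurwitz_delta_lt n x0 tau0 dt0; rewrite dtau => lt.
  apply: (lt_le_trans lt).
  apply: (ler_wpM2r (ltW (hurwitz_gt0 n (addr_gt0 x0 b0)))); apply: le_trans h.
  (* The bracket in the hypothesis equals [beta + 1 / (exp tau - 1)], so the threshold is [n.+2]
     minus the minimum of [delta_pot]. *)
  rewrite le_eqVlt; apply/orP; left; apply/eqP; rewrite /delta_pot.
  by field; rewrite gt_eqF// expR_sub1_gt0.
Qed.
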